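(* Let $\Gamma=(\gamma_n)_{n\ge1}$ be distinct complex numbers with $\inf_n|\gamma_{n+1}|/|\gamma_n|>1$, and let $v=(v_n)$ be positive with $\sum_nv_n/(1+|\gamma_n|^2)<\infty$. Let $\Lambda$ be a sequence of distinct points in $\mathbb{C}\setminus\Gamma$ and $w$ the Bessel weight sequence for $\Lambda$ with respect to $(\Gamma,v)$. Then $H_{(\Gamma,v);(\Lambda,w)}$ is bounded from $\ell^2_v$ to $\ell^2_w$ if and only if all of the following hold: $\sup_n\#(\Lambda\cap\Omega_n)<\infty$; $\Lambda^{(V)}$ is $V$-lacunary; $\Lambda^{(P)}$ is $P$-lacunary; and \[ \sup_{n\ge1}\left(V_n\sum_{m\ge n}\sum_{\lambda\in\Lambda^{(0)}\cap\Omega_m}\frac{|\lambda-\gamma_m|^2}{v_m|\lambda|^2}+P_n\sum_{m\le n}\sum_{\lambda\in\Lambda^{(0)}\cap\Omega_m}\frac{|\lambda-\gamma_m|^2}{v_m}\right)<\infty. \]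
   Context: $\ell^2_u=\{(a_k):\sum|a_k|^2u_k<\infty\}$ for positive $u$. $H_{(\Gamma,v)}a(z)=\sum_na_nv_n/(z-\gamma_n)$, and $H_{(\Gamma,v);(\Lambda,w)}a=(H_{(\Gamma,v)}a(\lambda_j))_j$. Bessel weight sequence: $w_j=(\sum_nv_n/|\lambda_j-\gamma_n|^2)^{-1}$. $\Omega_1=\{|z|<(|\gamma_1|+|\gamma_2|)/2\}$, $\Omega_n=\{(|\gamma_{n-1}|+|\gamma_n|)/2\le|z|<(|\gamma_n|+|\gamma_{n+1}|)/2\}$ for $n\ge2$. $V_1=1$, $V_n=\sum_{j=1}^{n-1}v_j$ for $n\ge2$, $P_n=\sum_{j=n+1}^\infty v_j/|\gamma_j|^2$. For $\lambda\in\Lambda$ let $n$ be the index with $\lambda\in\Omega_n$; then $\lambda\in\Lambda^{(0)}$ if $v_n/|\lambda-\gamma_n|^2\ge\max(V_n/|\lambda|^2,P_n)$; $\lambda\in\Lambda^{(V)}$ if $V_n/|\lambda|^2>\max(v_n/|\lambda-\gamma_n|^2,P_n)$; $\lambda\in\Lambda^{(P)}$ if $P_n>\max(v_n/|\lambda-\gamma_n|^2,V_n/|\lambda|^2)$. A sequence $\Lambda'$ is $V$-lacunary if $\sup_k\#\big(\Lambda'\cap\bigcup_{m:2^k\le V_m\le2^{k+1}}\Omega_m\big)<\infty$, and $P$-lacunary if $\sup_k\#\big(\Lambda'\cap\bigcup_{m:2^{-k-1}\le P_m\le2^{-k}}\Omega_m\big)<\infty$. *)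

(* Defs.v *)
From HB Require Import structures.
From mathcomp Require Import all_boot all_order all_algebra.
From mathcomp Require Import all_classical all_reals all_analysis.
From mathcomp Require Import complex.
Set Implicit Arguments. Unset Strict Implicit. Unset Printing Implicit Defensive.
Import Order.TTheory GRing.Theory Num.Theory.
Import numFieldNormedType.Exports.
Local Open Scope classical_set_scope.
Local Open Scope ring_scope.

Definition cabs (R : realType) (z : R[i]) : R := ComplexField.Normc.normc z.

(* R[i] seen as a numFieldType, so that it carries its normed topology
   (needed to take limits of complex partial sums) *)
Definition Cnum (R : realType) : numFieldType := R[i].

Section Defs.
Variable R : realType.
Local Notation C := (R[i]).

(* Indexing convention: the paper's gamma_n, v_n (n >= 1) are  g (n-1), v (n-1). *)

(* Annuli Omega_n  (paper's Omega_{n+1} is  Omega g n). *)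
Definition Omega (g : nat -> C) (n : nat) : set C :=
  match n with
  | 0 => [set z | cabs z < (cabs (g 0%N) + cabs (g 1%N)) / 2]
  | k.+1 => [set z | (cabs (g k) + cabs (g k.+1)) / 2 <= cabs z /\
                     cabs z < (cabs (g k.+1) + cabs (g k.+2)) / 2]
  end.

Definition Vseq (v : nat -> R) (n : nat) : R :=
  match n with 0 => 1 | _ => \sum_(j < n) v j end.

Definition Pseq (g : nat -> C) (v : nat -> R) (n : nat) : R :=
  \big[+%R/0%R]_(n.+1 <= j <oo) (v j / cabs (g j) ^+ 2).

Definition bessel_weight (g : nat -> C) (v : nat -> R) (l : C) : R :=
  (\big[+%R/0%R]_(0 <= n <oo) (v n / cabs (l - g n) ^+ 2))^-1.

Definition hilbert (g : nat -> C) (v : nat -> R) (a : nat -> C) (z : C) : C :=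
  limn (fun N => \sum_(0 <= n < N) (a n * ((v n)%:C)%C / (z - g n) : Cnum R)).

(* The three quantities compared in the definition of Lambda^(0),(V),(P),
   as extended reals (V_n/|lambda|^2 = +oo when lambda = 0). *)
Definition qv (g : nat -> C) (v : nat -> R) (n : nat) (l : C) : \bar R :=
  (v n / cabs (l - g n) ^+ 2)%:E.
Definition qV (v : nat -> R) (n : nat) (l : C) : \bar R :=
  if l == 0 then +oo%E else (Vseq v n / cabs l ^+ 2)%:E.
Definition qP (g : nat -> C) (v : nat -> R) (n : nat) : \bar R :=
  (Pseq g v n)%:E.

Definition Lam0 (g : nat -> C) (v : nat -> R) (L : set C) : set C :=
  [set l | L l /\ exists n, Omega g n l /\
     (Order.max (qV v n l) (qP g v n) <= qv g v n l)%E].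
Definition LamV (g : nat -> C) (v : nat -> R) (L : set C) : set C :=
  [set l | L l /\ exists n, Omega g n l /\
     (Order.max (qv g v n l) (qP g v n) < qV v n l)%E].
Definition LamP (g : nat -> C) (v : nat -> R) (L : set C) : set C :=
  [set l | L l /\ exists n, Omega g n l /\
     (Order.max (qv g v n l) (qV v n l) < qP g v n)%E].

Definition atmost {T} (A : set T) (M : nat) : Prop := (A #<= `I_M)%card.

Definition V_lacunary (g : nat -> C) (v : nat -> R) (L' : set C) : Prop :=
  exists M : nat, forall k : int,
    atmost (L' `&` \bigcup_(m in [set m | (2:R) ^ k <= Vseq v m <= (2:R) ^ (k + 1)]) Omega g m) M.

Definition P_lacunary (g : nat -> C) (v : nat -> R) (L' : set C) : Prop :=
  exists M : nat, forall k : int,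
    atmost (L' `&` \bigcup_(m in [set m | (2:R) ^ (- k - 1) <= Pseq g v m <= (2:R) ^ (- k)]) Omega g m) M.

Definition l2norm_nat (v : nat -> R) (a : nat -> C) : \bar R :=
  (\sum_(0 <= n <oo) ((cabs (a n)) ^+ 2 * v n)%:E)%E.

Definition hilbert_bounded (g : nat -> C) (v : nat -> R) (L : set C) (w : C -> R) : Prop :=
  exists K : R, forall a : nat -> C, (l2norm_nat v a < +oo)%E ->
    (\esum_(l in L) ((cabs (hilbert g v a l)) ^+ 2 * w l)%:E
      <= K%:E * l2norm_nat v a)%E.

End Defs.

(* Main.v *)
Require Import Defs.
From HB Require Import structures.
From mathcomp Require Import all_boot all_order all_algebra.
From mathcomp Require Import all_classical all_reals all_analysis.
From mathcomp Require Import finmap complex.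
From mathcomp Require Import ring lra zify.
Set Implicit Arguments. Unset Strict Implicit. Unset Printing Implicit Defensive.
Import Order.TTheory GRing.Theory Num.Theory.
Import numFieldNormedType.Exports.
Local Open Scope classical_set_scope.
Local Open Scope ring_scope.

(** For [l] in [Omega g n] the inverse weight is comparable with
    [V_n / |l|^2 + v_n / |l - g n|^2 + P_n] (without the first summand when
    [n = 0]).  Splitting the transform at [j < n], [j = n], [j > n] reduces
    boundedness to a diagonal estimate and two discrete weighted Hardy
    inequalities, hence, by Muckenhoupt's criterion, to uniform bounds for
    [V_m * sum_(level l >= m) w l / |l|^2] and [P_m * sum_(level l <= m) w l]
    over finite sets of points; the sequences [1] on [j < m], [1 / conj (g j)]
    on [j > m] and the unit vectors show that these bounds are also necessary.
    On [Lam0] the two bounds are the displayed supremum.  On [LamV] the first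
    one is [V]-lacunarity, and the second one then comes for free: if [V]
    decreases by a fixed factor below a point [l] where [V_n / |l|^2 >= P_n],
    the mass in between raises [P] by a fixed factor, so that [LamV] is also
    [P]-lacunary.  [LamP] is symmetric.  Points with
    [V_n / |l|^2 = P_n > v_n / |l - g n|^2] belong to none of the three classes;
    they are lacunary in both senses because their moduli grow geometrically. *)

(** The obstacle is an asymmetry: each Hardy condition sums over all points, whereas a class is
    assumed lacunary for only one of [V] and [P], and ties for neither. The bridge is that [V] and
    [P] are built from the same masses: where [|g j| >= |l|], the increment of [V] is at least
    [|l|^2] times the decrement of [P], and where [|g j| <= |l|] it is at most that. At a tie
    [V = P |l|^2]. If [V] grew by less than the factor [2 - 1/q] over two levels, the spacing of the
    moduli would make [P] drop by the factor [q], and the bridge would then make [V] grow by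
    [2 - 1/q] after all at the next level; so the number of points per annulus is enough for ties.
    The convention [V = 1] on the first annulus does not match the splitting, where the sum over
    [j < 0] is empty. Points of level 0 are therefore set apart wherever the two meet. Limits are
    total functions, so the estimates are made on finite lists of points and truncated sequences. *)

(** * Discrete weighted Hardy inequality *)

(** With [al] the new average, [V' * U <= C] bounds the first term by [2 * C * x * v * al], and the
    tangent bound [E2] bounds the second by [C * v * (2 * x * al - al ^+ 2)]; the gap to the right
    side is exactly [C * v * (2 * x - al) ^+ 2]. The condition on [V = 0] covers the first step,
    where [A ^+ 2 / V] is [0]. *)
Lemma hardy_step (R : realFieldType) (U V V' A x v C : R) :
  0 <= U -> 0 <= V -> 0 < v -> V' = V + v -> 0 <= A -> 0 <= x -> 0 <= C ->
  (V = 0 -> A = 0) -> V' * U <= C ->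
  U * ((A + x * v) ^+ 2 - A ^+ 2) + C * ((A + x * v) ^+ 2 / V' - A ^+ 2 / V)
    <= 4 * C * (x ^+ 2 * v).
Proof.
move=> U0 V0 v0 VE A0 x0 C0 VA VU.
have V'0 : 0 < V' by rewrite VE; lra.
set al := (A + x * v) / V'.
have xv0 : 0 <= x * v by apply: mulr_ge0 => //; lra.
have al0 : 0 <= al by apply: divr_ge0; lra.
have AE : A + x * v = V' * al by rewrite /al; field; lra.
have E1 : (A + x * v) ^+ 2 / V' = V' * al ^+ 2 by rewrite AE; field; lra.
have E2 : 2 * al * A - al ^+ 2 * V <= A ^+ 2 / V.
  have [V00|Vn0] := eqVneq V 0.
    by rewrite (VA V00) V00 expr0n /= mul0r !mulr0 subr0.
  have Vp : 0 < V by rewrite lt_def Vn0.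
  rewrite ler_pdivlMr// -subr_ge0.
  have -> : A ^+ 2 - (2 * al * A - al ^+ 2 * V) * V = (A - al * V) ^+ 2 by ring.
  exact: sqr_ge0.
have E3 : U * ((A + x * v) ^+ 2 - A ^+ 2) <= 2 * C * (x * v * al).
  have -> : (A + x * v) ^+ 2 - A ^+ 2 = (x * v) * (A + (A + x * v)) by ring.
  apply: (@le_trans _ _ (U * (x * v * (2 * (A + x * v))))).
    by apply: ler_wpM2l => //; apply: ler_wpM2l => //; lra.
  rewrite AE.
  have -> : U * (x * v * (2 * (V' * al))) = 2 * (V' * U) * (x * v * al) by ring.
  apply: ler_wpM2r; first exact: mulr_ge0.
  by apply: ler_wpM2l => //; lra.
have E4 : C * ((A + x * v) ^+ 2 / V' - A ^+ 2 / V) <=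
          C * (V' * al ^+ 2 - (2 * al * (V' * al - x * v) - al ^+ 2 * V)).
  by apply: ler_wpM2l => //; rewrite E1 -AE; lra.
have E5 : 0 <= C * v * (2 * x - al) ^+ 2.
  by apply: mulr_ge0; [apply: mulr_ge0 => //; lra | exact: sqr_ge0].
apply: (le_trans (lerD E3 E4)); rewrite -subr_ge0.
by apply: (le_trans E5); rewrite VE le_eqVlt; apply/orP; left; apply/eqP; ring.
Qed.

(* The invariant carried along [n] is the sum truncated at level [n] plus the
   boundary term [C * A n ^+ 2 / V n], where [A n] and [V n] are the partial
   sums of [x j * v j] and [v j]. *)
Lemma hardy_finite (R : realFieldType) (T : eqType) (s : seq T) (lev : T -> nat)
    (u : T -> R) (v x : nat -> R) (C : R) (N : nat) :
  (forall t, 0 <= u t) -> (forall j, 0 < v j) -> (forall j, 0 <= x j) ->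
  0 <= C ->
  (forall m, (0 < m <= N)%N ->
    (\sum_(j < m) v j) * (\sum_(t <- s | (m <= lev t)%N) u t) <= C) ->
  (forall t, t \in s -> (lev t <= N)%N) ->
  \sum_(t <- s) u t * (\sum_(j < lev t) x j * v j) ^+ 2
    <= 4 * C * \sum_(j < N) x j ^+ 2 * v j.
Proof.
move=> u0 v0 x0 C0 VU levN.
pose A n := \sum_(j < n) x j * v j.
pose V n := \sum_(j < n) v j.
have A0 n : 0 <= A n by apply: sumr_ge0 => j _; apply: mulr_ge0 => //; exact: ltW.
have V0 n : 0 <= V n by apply: sumr_ge0 => j _; exact: ltW.
have key n : (n <= N)%N ->
  \sum_(t <- s) u t * A (minn (lev t) n) ^+ 2 + C * (A n ^+ 2 / V n)
    <= 4 * C * \sum_(j < n) x j ^+ 2 * v j.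
  elim: n => [_|n IH nN].
    rewrite /A !big_ord0 expr0n /= mul0r !mulr0 addr0 big1// => t _.
    by rewrite mulr0.
  have {}IH := IH (ltnW nN).
  rewrite [X in _ <= _ * X]big_ord_recr /= mulrDr.
  have Ustep := @hardy_step R (\sum_(t <- s | (n.+1 <= lev t)%N) u t)
    (V n) (V n.+1) (A n) (x n) (v n) C.
  have AS : A n.+1 = A n + x n * v n by rewrite /A big_ord_recr.
  have VS : V n.+1 = V n + v n by rewrite /V big_ord_recr.
  have VA : V n = 0 -> A n = 0.
    case: (n) => [|k]; first by rewrite /A big_ord0.
    rewrite /V big_ord_recr /= => E; have := v0 k; have := V0 k.
    by rewrite /V; lra.
  have H := VU n.+1; rewrite /= nN in H; have {}H := H isT.
  have U0 : 0 <= \sum_(t <- s | (n < lev t)%N) u t by apply: sumr_ge0.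
  have {}Ustep := Ustep U0 (V0 n) (v0 n) VS (A0 n) (x0 n) C0 VA H.
  rewrite -AS in Ustep.
  have SE : \sum_(t <- s) u t * A (minn (lev t) n.+1) ^+ 2 =
     \sum_(t <- s) u t * A (minn (lev t) n) ^+ 2 +
     (\sum_(t <- s | (n.+1 <= lev t)%N) u t) * (A n.+1 ^+ 2 - A n ^+ 2).
    rewrite mulr_suml [X in _ + X]big_mkcond /= -big_split /=.
    apply: eq_bigr => t _; case: ltnP => h; first by rewrite (minn_idPr h); ring.
    by rewrite (minn_idPl (leqW h)) addr0.
  rewrite SE; lra.
have := key N (leqnn N).
have -> : \sum_(t <- s) u t * A (minn (lev t) N) ^+ 2 =
          \sum_(t <- s) u t * (\sum_(j < lev t) x j * v j) ^+ 2.
  rewrite big_seq [RHS]big_seq; apply: eq_bigr => t /levN h.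
  by rewrite (minn_idPl _).
have : 0 <= C * (A N ^+ 2 / V N).
  by apply: mulr_ge0 => //; apply: divr_ge0 => //; exact: sqr_ge0.
lra.
Qed.

(** * Lacunary sums and counting in blocks *)

Lemma ler_sum_cond (R : numDomainType) (T : eqType) (s : seq T) (P Q : pred T)
    (f g : T -> R) :
  (forall t, t \in s -> P t -> Q t /\ f t <= g t) ->
  (forall t, t \in s -> Q t -> 0 <= g t) ->
  \sum_(t <- s | P t) f t <= \sum_(t <- s | Q t) g t.
Proof.
move=> h g0; rewrite big_mkcond [X in _ <= X]big_mkcond /= big_seq.
rewrite [X in _ <= X]big_seq; apply: ler_sum => t ts.
case: ifP => [/(h t ts)[-> //]|_]; by case: ifP => // /(g0 t ts).
Qed.

Lemma expr_unbounded (R : realType) (th x : R) : 1 < th -> exists n, x < th ^+ n.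
Proof.
move=> th1; have h0 : 0 < th - 1 by lra.
have bern n : 1 + (th - 1) *+ n <= th ^+ n.
  elim: n => [|n IH]; first by rewrite mulr0n addr0.
  have p0 : 0 <= (th - 1) *+ n by rewrite mulrn_wge0// ltW.
  rewrite exprS mulrS; apply: (le_trans _ (ler_wpM2l (ltW (lt_trans ltr01 th1)) IH)).
  have : 0 <= (th - 1) * ((th - 1) *+ n) by apply: mulr_ge0 => //; lra.
  by set p := _ *+ n; lra.
have nE := archi_boundP (normr_ge0 (x / (th - 1))).
exists (Num.bound `|x / (th - 1)|); apply: lt_le_trans (bern _).
have : x / (th - 1) < (Num.bound `|x / (th - 1)|)%:R by exact: le_lt_trans (ler_norm _) nE.
by rewrite ltr_pdivrMr// -mulr_natl; lra.
Qed.

(** A geometric series over blocks of ratio [th]. The bound reproduces itself: [M / x] for the first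
    block plus the bound at [th * x] for the rest is the bound at [x]. *)
Lemma lacunary_sum (R : realType) (T : eqType) (s : seq T) (f : T -> R) (th M : R) :
  1 < th ->
  (forall x : R, 0 < x -> (count (fun t => x <= f t < th * x) s)%:R <= M) ->
  forall x : R, 0 < x ->
  \sum_(t <- s | x <= f t) (f t)^-1 <= M * (th / (th - 1)) / x.
Proof.
move=> th1 hc.
have th0 : 0 < th by lra.
have h0 : 0 < th - 1 by lra.
have M0 : 0 <= M by apply: le_trans (hc 1 ltr01); rewrite ler0n.
have key k (x : R) : 0 < x ->
  \sum_(t <- s | x <= f t < th ^+ k * x) (f t)^-1 <= M * (th / (th - 1)) / x.
  elim: k x => [x x0|k IH x x0].
    rewrite big_pred0; last by move=> t; rewrite expr0 mul1r; case: leP.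
    by apply: divr_ge0; [apply: mulr_ge0 => //; apply: divr_ge0; lra | lra].
  have thx : 0 < th * x by exact: mulr_gt0.
  rewrite (bigID (fun t => f t < th * x)) /=.
  have S1 : \sum_(t <- s | (x <= f t < th ^+ k.+1 * x) && (f t < th * x)) (f t)^-1
      <= M / x.
    apply: (@le_trans _ _ (\sum_(t <- s | x <= f t < th * x) x^-1)).
      apply: ler_sum_cond => [t _ /andP[/andP[h1 _] h2]|t _ _].
        split; first by rewrite h1 h2.
        by rewrite lef_pV2 ?posrE//; exact: lt_le_trans h1.
      by rewrite invr_ge0 ltW.
    rewrite big_const_seq iter_addr_0 -mulr_natl.
    by apply: ler_wpM2r; [rewrite invr_ge0; lra | exact: hc].
  have S2 : \sum_(t <- s | (x <= f t < th ^+ k.+1 * x) && ~~ (f t < th * x)) (f t)^-1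
      <= M * (th / (th - 1)) / (th * x).
    apply: le_trans (IH _ thx); rewrite le_eqVlt; apply/orP; left; apply/eqP.
    apply: eq_bigl => t; rewrite -leNgt exprSr mulrA andbC.
    case: (leP (th * x) (f t)) => //= h.
    suff -> : x <= f t by [].
    by apply: le_trans h; rewrite ler_peMl//; lra.
  apply: (le_trans (lerD S1 S2)); rewrite le_eqVlt; apply/orP; left; apply/eqP.
  by field; rewrite !gt_eqF//=; lra.
move=> x x0.
have [k kE] : exists k, forall t, t \in s -> f t < th ^+ k * x.
  elim: (s) => [|a s' [k IH]]; first by exists 0%N.
  have [n nE] := @expr_unbounded R th (f a / x) th1.
  exists (maxn n k) => t; rewrite inE => /predU1P[->|/IH h].
    rewrite -ltr_pdivrMr//; apply: (lt_le_trans nE); apply: ler_weXn2l; [lra|exact: leq_maxl].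
  apply: (lt_le_trans h); rewrite ler_pM2r//; apply: ler_weXn2l; [lra|exact: leq_maxr].
apply: le_trans (key k x x0); rewrite le_eqVlt; apply/orP; left; apply/eqP.
rewrite big_seq_cond [RHS]big_seq_cond; apply: eq_bigl => t.
by case: (boolP (t \in s)) => //= /kE ->; rewrite andbT.
Qed.

Lemma count_le3 (T : eqType) (s : seq T) (p q1 q2 q3 : pred T) :
  (forall t, t \in s -> p t -> [|| q1 t, q2 t | q3 t]) ->
  (count p s <= count q1 s + count q2 s + count q3 s)%N.
Proof.
elim: s => //= a s IH h.
have {}IH : (count p s <= count q1 s + count q2 s + count q3 s)%N.
  by apply: IH => t ts; apply: h; rewrite inE ts orbT.
have := h a (mem_head _ _).
by case: (p a); case: (q1 a); case: (q2 a); case: (q3 a) => //=; lia.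
Qed.

Lemma exists_argmin_seq (T : eqType) (s : seq T) (f : T -> nat) :
  s <> [::] -> exists2 a, a \in s & forall t, t \in s -> (f a <= f t)%N.
Proof.
elim: s => // a [|b s] IH _.
  by exists a; rewrite ?mem_head// => t; rewrite inE => /eqP->.
have [//|c cs cmin] := IH; have [ac|ca] := leqP (f a) (f c).
  exists a; rewrite ?mem_head// => t; rewrite inE => /predU1P[->//|/cmin].
  exact: leq_trans.
exists c; first by rewrite inE cs orbT.
by move=> t; rewrite inE => /predU1P[->|/cmin//]; exact: ltnW.
Qed.

Lemma exists_argmax_seq (T : eqType) (s : seq T) (f : T -> nat) :
  s <> [::] -> exists2 a, a \in s & forall t, t \in s -> (f t <= f a)%N.
Proof.
elim: s => // a [|b s] IH _.
  by exists a; rewrite ?mem_head// => t; rewrite inE => /eqP->.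
have [//|c cs cmax] := IH; have [ca|ac] := leqP (f c) (f a).
  exists a; rewrite ?mem_head// => t; rewrite inE => /predU1P[->//|/cmax h].
  exact: leq_trans ca.
exists c; first by rewrite inE cs orbT.
by move=> t; rewrite inE => /predU1P[->|/cmax//]; exact: ltnW.
Qed.

(** Abstract form of the exchange between [V] and [P]: a drop of [h] between [a] and [b] forces [f]
    to grow by [th] between [a] and [c]. [lev] stays abstract so that reversed levels can be used
    too. *)
Section Counting.
Variables (R : realFieldType) (T : eqType) (s : seq T).
Variables (lev : T -> nat) (f h : T -> R) (ka th : R) (M : nat).
Hypothesis ka1 : 1 < ka.
Hypothesis th0 : 0 <= th.
Hypothesis level_count : forall n, (count (fun t => lev t == n) s <= M)%N.
Hypothesis growth : forall a b c, a \in s -> b \in s -> c \in s ->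
  (lev a < lev b)%N -> (lev b < lev c)%N -> ka * h b < h a -> th * f a <= f c.

(* Points strictly between the lowest and the highest level of a block of [f]
   all have [h] comparable to its value at the lowest point. *)
Lemma step_count (Mh : nat) :
  (forall x : R, 0 < x -> (count (fun t => x <= h t < ka * x)%R s <= Mh)%N) ->
  (forall a, a \in s -> 0 < h a) ->
  (forall a b, a \in s -> b \in s -> (lev a < lev b)%N -> h b < h a) ->
  forall x : R, (count (fun t => x <= f t < th * x)%R s <= M + Mh + M)%N.
Proof.
move=> hlac h0 hmono x; set p := fun t => _.
have [G0|/eqP G0] := eqVneq [seq t <- s | p t] [::].
  by rewrite -size_filter G0.
have [a] := exists_argmin_seq lev G0; rewrite mem_filter => /andP[pa as_] amin.
have [c] := exists_argmax_seq lev G0; rewrite mem_filter => /andP[pc cs] cmax.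
have ka0 : 0 < ka by exact: lt_trans ltr01 ka1.
apply: leq_trans (leq_add (leq_add (level_count (lev a))
  (hlac (h a / ka) (divr_gt0 (h0 _ as_) ka0))) (level_count (lev c))).
apply: count_le3 => t ts pt.
have tG : t \in [seq t <- s | p t] by rewrite mem_filter pt.
have := amin _ tG; have := cmax _ tG.
rewrite leq_eqVlt => /predU1P[-> _|tc]; first by rewrite eqxx !orbT.
rewrite leq_eqVlt => /predU1P[->|at_]; first by rewrite eqxx.
have -> : ka * (h a / ka) = h a by field; rewrite gt_eqF.
rewrite (hmono a t)// andbT ler_pdivrMr//.
suff -> : h a <= h t * ka by rewrite orbT.
rewrite leNgt; apply/negP; rewrite mulrC => hh.
have := growth as_ ts cs at_ tc hh.
move: pa pc; rewrite /p => /andP[xa _] /andP[_ cx].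
by have := ler_wpM2l th0 xa; clear pt tG; lra.
Qed.

(** Here [h] is not known to be lacunary. A point of the block below the highest level but at least
    two levels above the lowest would have [h] smaller by the factor [ka], and [growth] would push
    the highest point out of the block. Only the lowest level, the next one and the highest
    remain. *)
Lemma tie_count :
  (forall a b, a \in s -> b \in s -> ((lev a).+1 < lev b)%N -> 
     f b < th * f a -> ka * h b < h a) ->
  forall x : R, (count (fun t => x <= f t < th * x)%R s <= M + M + M)%N.
Proof.
move=> tie x; set p := fun t => _.
have [G0|/eqP G0] := eqVneq [seq t <- s | p t] [::].
  by rewrite -size_filter G0.
have [a] := exists_argmin_seq lev G0; rewrite mem_filter => /andP[pa as_] amin.
have [c] := exists_argmax_seq lev G0; rewrite mem_filter => /andP[pc cs] cmax.
apply: leq_trans (leq_add (leq_add (level_count (lev a))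
  (level_count (lev a).+1)) (level_count (lev c))).
apply: count_le3 => t ts pt.
have tG : t \in [seq t <- s | p t] by rewrite mem_filter pt.
have := amin _ tG; have := cmax _ tG.
rewrite leq_eqVlt => /predU1P[-> _|tc]; first by rewrite eqxx !orbT.
rewrite leq_eqVlt => /predU1P[->|at_]; first by rewrite eqxx.
move: at_; rewrite leq_eqVlt => /predU1P[->|at2]; first by rewrite eqxx orbT.
exfalso; move: pa pc pt; rewrite /p => /andP[xa _] /andP[_ cx] /andP[_ tx].
have thxa := ler_wpM2l th0 xa.
have hh := tie a t as_ ts at2 (lt_le_trans tx thxa).
have := growth as_ ts cs (ltnW at2) tc hh; lra.
Qed.

End Counting.

(** * Finite lists, cardinals and nonnegative series *)

Lemma sum_cond_all (V : nmodType) (T : eqType) (s : seq T) (Q : pred T) (f : T -> V) :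
  (forall t, t \in s -> Q t) -> \sum_(t <- s | Q t) f t = \sum_(t <- s) f t.
Proof.
move=> h; rewrite big_seq_cond [RHS]big_seq; apply: eq_bigl => t.
by case: (boolP (t \in s)) => //= /h.
Qed.

Lemma atmostP (T : choiceType) (A : set T) (M : nat) :
  atmost A M <->
  forall s : seq T, uniq s -> (forall t, t \in s -> A t) -> (size s <= M)%N.
Proof.
split=> [AM s us sA|h].
  rewrite -card_le_II; apply: card_le_trans AM.
  have sE : [set` [fset x in s]%fset] `<=` A by move=> t /=; rewrite inE => /sA.
  apply: card_le_trans (subset_card_le sE).
  have /card_eq_fsetP : #|` [fset x in s]%fset| = size s by rewrite card_fseq undup_id.
  by rewrite card_eq_le => /andP[].
have [/finite_fsetP [F AF]|/(infinite_set_fset M.+1)[F FA FM]] := pselect (finite_set A).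
  rewrite /atmost AF.
  have /card_eq_fsetP : #|` F| = #|` F| by [].
  rewrite card_eq_le => /andP[/card_le_trans + _]; apply.
  by rewrite card_le_II h ?fset_uniq// => t tF; rewrite AF.
have := h F (fset_uniq F) FA; rewrite leqNgt => /negP; elim.
by apply: leq_trans FM.
Qed.

Lemma esum_ge_seq (R : realType) (T : choiceType) (A : set T) (f : T -> \bar R)
    (s : seq T) :
  uniq s -> (forall t, t \in s -> A t) ->
  (\sum_(t <- s) f t <= \esum_(t in A) f t)%E.
Proof.
move=> us sA; apply: esum_ge; exists [set` s].
  by split; [exact: finite_seq | move=> t /= /sA].
by rewrite fsbig_seq.
Qed.

Lemma esum_le_seq (R : realType) (T : choiceType) (A : set T) (f : T -> \bar R)
    (K : \bar R) :
  (forall s : seq T, uniq s -> (forall t, t \in s -> A t) ->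
    (\sum_(t <- s) f t <= K)%E) ->
  (\esum_(t in A) f t <= K)%E.
Proof.
move=> h; apply: ge_ereal_sup => _ [X [finX XA] <-].
rewrite fsbig_finite//; apply: h; first exact: fset_uniq.
by move=> t; rewrite in_fset_set// => /set_mem/XA.
Qed.

(** [Pseq] and [bessel_weight] are built on real limits, which say nothing until the partial sums
    are known to be bounded; with that bound they can be used as suprema of partial sums. *)
Section NonnegativeSeries.
Variables (R : realType) (u : nat -> R) (m : nat) (B : R).
Hypothesis u0 : forall j, 0 <= u j.
Hypothesis uB : forall N, \sum_(m <= j < N) u j <= B.

Lemma nnseries_cvg : cvgn (fun N => \sum_(m <= j < N) u j).
Proof.
apply: nondecreasing_is_cvgn.
  by apply: (nondecreasing_series (P := xpredT)) => n _ _; exact: u0.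
by exists B => _ [N _ <-]; exact: uB.
Qed.

Lemma nnseries_ge N : \sum_(m <= j < N) u j <= \big[+%R/0]_(m <= j <oo) u j.
Proof.
apply: (nondecreasing_cvgn_le _ nnseries_cvg).
by apply: (nondecreasing_series (P := xpredT)) => n _ _; exact: u0.
Qed.

Lemma nnseries_le B' : (forall N, \sum_(m <= j < N) u j <= B') ->
  \big[+%R/0]_(m <= j <oo) u j <= B'.
Proof.
by move=> h; apply: limr_le; [exact: nnseries_cvg | near=> N; exact: h].
Unshelve. all: by end_near. Qed.

End NonnegativeSeries.

Lemma exists_dyadic (R : realType) (x : R) : 0 < x ->
  exists k : int, (2 : R) ^ k <= x < (2 : R) ^ (k + 1).
Proof.
move=> x0.
have up (y : R) : 1 <= y -> exists k : nat, (2 : R) ^+ k <= y < (2 : R) ^+ k.+1.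
  move=> y1; have [n] := @expr_unbounded R 2 y (ltr1n _ _).
  elim: n => [|n IH] yn; first by rewrite expr0 in yn; lra.
  have [/IH//|ny] := ltP y (2 ^+ n).
  by exists n; rewrite ny yn.
have [x1|x1] := leP 1 x.
  have [k /andP[k1 k2]] := up _ x1; exists k%:Z.
  by rewrite -PoszD addn1 -!exprnP k1 k2.
have [|k /andP[k1 k2]] := up x^-1; first by rewrite invf_ge1 ?ltW.
(* Inversion exchanges the open and the closed end of a dyadic interval, so the endpoint needs its
   own exponent. *)
have [E|NE] := eqVneq ((2:R) ^+ k) x^-1.
  exists (- k%:Z); rewrite -invr_expz -exprnP E invrK lexx /=.
  rewrite exprzDr ?unitfE ?pnatr_eq0// -invr_expz -exprnP E invrK expr1z.
  by rewrite ltr_pMr// ltr1n.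
exists (- k.+1%:Z); rewrite -invr_expz -exprnP.
have -> : (- k.+1%:Z + 1) = - k%:Z by lia.
rewrite -invr_expz -exprnP.
have p k' : 0 < (2:R) ^+ k' by apply: exprn_gt0; rewrite ltr0n.
apply/andP; split.
  by rewrite -(invrK x) lef_pV2 ?posrE ?invr_gt0// ltW.
by rewrite -[X in X < _](invrK x) ltf_pV2 ?posrE ?invr_gt0// lt_neqAle NE.
Qed.

(** * Complex series *)

Section ComplexSeries.
Variable R : realType.

Lemma Re_sum (I : Type) (s : seq I) (P : pred I) (F : I -> R[i]) :
  complex.Re (\sum_(i <- s | P i) F i) = \sum_(i <- s | P i) complex.Re (F i).
Proof. by apply: (big_morph (@complex.Re R)) => // -[a b] [e f]. Qed.

Lemma Im_sum (I : Type) (s : seq I) (P : pred I) (F : I -> R[i]) :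
  complex.Im (\sum_(i <- s | P i) F i) = \sum_(i <- s | P i) complex.Im (F i).
Proof. by apply: (big_morph (@complex.Im R)) => // -[a b] [e f]. Qed.

Lemma cabs_sqr (z : R[i]) :
  cabs z ^+ 2 = complex.Re z ^+ 2 + complex.Im z ^+ 2.
Proof. by case: z => a b; rewrite /cabs /= sqr_sqrtr// addr_ge0 ?sqr_ge0. Qed.

Lemma normRe_le (z : R[i]) : `|complex.Re z| <= cabs z.
Proof.
case: z => a b; rewrite /cabs /=.
by rewrite -sqrtr_sqr ler_wsqrtr// lerDl sqr_ge0.
Qed.

Lemma normIm_le (z : R[i]) : `|complex.Im z| <= cabs z.
Proof.
case: z => a b; rewrite /cabs /=.
by rewrite -sqrtr_sqr ler_wsqrtr// lerDr sqr_ge0.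
Qed.

Lemma cabs_leReIm (z : R[i]) : cabs z <= `|complex.Re z| + `|complex.Im z|.
Proof.
rewrite -ler_sqr ?nnegrE ?sqrtr_ge0 ?addr_ge0//; last by case: z => a b; exact: sqrtr_ge0.
rewrite cabs_sqr sqrrD !real_normK ?num_real// -addrA lerD2l addrC lerDl.
by rewrite mulrn_wge0// mulr_ge0.
Qed.

Lemma cvg_complex (f : nat -> R[i]) (x y : R) :
  (fun N => complex.Re (f N)) @ \oo --> x ->
  (fun N => complex.Im (f N)) @ \oo --> y ->
  (f : nat -> Cnum R) @ \oo --> ((x +i* y)%C : Cnum R).
Proof.
move=> fx fy; apply/cvgrPdist_lt => e e0.
(* The radius [e] is a complex number; being positive, it has imaginary part zero. *)
have [er er0 eE] : exists2 r : R, 0 < r & e = r%:C%C.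
  exists (complex.Re e); first by case: e e0 => a b /=; rewrite ltcE /= => /andP[_].
  by case: e e0 => a b /=; rewrite ltcE /= => /andP[/eqP-> _].
have e2 : 0 < er / 2 by rewrite divr_gt0.
move/cvgrPdist_lt : fx => /(_ _ e2) fx; move/cvgrPdist_lt : fy => /(_ _ e2) fy.
near=> N.
have hx : `|x - complex.Re (f N)| < er / 2 by near: N.
have hy : `|y - complex.Im (f N)| < er / 2 by near: N.
have -> : `|(x +i* y)%C - f N : Cnum R| = (cabs ((x +i* y)%C - f N))%:C%C by [].
rewrite eE ltcR; apply: le_lt_trans (cabs_leReIm _) _.
by case: (f N) hx hy => a b /= hx hy; lra.
Unshelve. all: by end_near. Qed.

(** [hilbert] is a limit in [Cnum]; absolute convergence is what makes its real and imaginary parts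
    the limits of those of the partial sums. *)
Lemma cvg_complex_series (t : nat -> R[i]) (B : R) :
  (forall N, \sum_(0 <= j < N) cabs (t j) <= B) ->
  let l := limn (fun N => \sum_(0 <= n < N) (t n : Cnum R)) in
  (fun N => complex.Re (\sum_(0 <= n < N) t n)) @ \oo --> complex.Re l /\
  (fun N => complex.Im (\sum_(0 <= n < N) t n)) @ \oo --> complex.Im l.
Proof.
move=> tB.
have part (f : R[i] -> R) : (forall z, `|f z| <= cabs z) ->
    cvgn (fun N => \sum_(0 <= j < N) f (t j)).
  move=> fle.
  have : cvgn [normed series (fun j => f (t j))].
    apply: nondecreasing_is_cvgn.
      apply: (nondecreasing_series (P := xpredT)) => n _ _; exact: normr_ge0.
    exists B => _ [N _ <-]; apply: le_trans (tB N).
    by apply: ler_sum => j _; exact: fle.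
  move/normed_cvg; exact.
have xE := part (@complex.Re R) normRe_le; set x := lim _ in xE.
have yE := part (@complex.Im R) normIm_le; set y := lim _ in yE.
have {}xE : (fun N => complex.Re (\sum_(0 <= n < N) t n)) @ \oo --> x.
  by under eq_fun do rewrite Re_sum.
have {}yE : (fun N => complex.Im (\sum_(0 <= n < N) t n)) @ \oo --> y.
  by under eq_fun do rewrite Im_sum.
by have := cvg_complex xE yE => /cvg_lim -> //; exact: norm_hausdorff.
Qed.

Lemma cvg_complex_finite (t : nat -> R[i]) (M : nat) :
  (forall n, (M <= n)%N -> t n = 0) ->
  limn (fun N => \sum_(0 <= n < N) (t n : Cnum R)) = \sum_(0 <= n < M) t n.
Proof.
move=> t0; apply: cvg_lim; first exact: norm_hausdorff.
apply: cvg_near_cst; near=> N.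
have MN : (M <= N)%N by near: N; exact: nbhs_infty_ge.
rewrite (big_cat_nat (leq0n M) MN) /= [X in _ + X]big_nat.
by rewrite [X in _ + X]big1 ?addr0// => j /andP[/t0].
Unshelve. all: by end_near. Qed.

End ComplexSeries.

(** * The complex modulus *)

Section ComplexModulus.
Variable R : realType.
Implicit Types z w : R[i].

Lemma cabsE z : `|z| = (cabs z)%:C%C.
Proof. by []. Qed.

Lemma cabs_ge0 z : 0 <= cabs z.
Proof. by rewrite -lecR -cabsE normr_ge0. Qed.

Lemma cabsM z w : cabs (z * w) = cabs z * cabs w.
Proof. exact: ComplexField.Normc.normcM. Qed.

Lemma cabsV z : cabs z^-1 = (cabs z)^-1.
Proof. exact: ComplexField.Normc.normcV. Qed.

Lemma cabs0 : cabs (0 : R[i]) = 0.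
Proof. exact: ComplexField.Normc.normc0. Qed.

Lemma cabs_gt0 z : (0 < cabs z) = (z != 0).
Proof. by rewrite -normr_gt0 cabsE ltcR. Qed.

Lemma cabsD z w : cabs (z + w) <= cabs z + cabs w.
Proof. by rewrite -lecR rmorphD /= -!cabsE ler_normD. Qed.

Lemma cabsN z : cabs (- z) = cabs z.
Proof. by apply: complexI; rewrite -!cabsE normrN. Qed.

Lemma cabsB z w : cabs (z - w) <= cabs z + cabs w.
Proof. by rewrite -(cabsN w) cabsD. Qed.

Lemma cabsBC z w : cabs (z - w) = cabs (w - z).
Proof. by rewrite -opprB cabsN. Qed.

Lemma cabsB_ge z w : cabs z - cabs w <= cabs (z - w).
Proof. by have := cabsD (z - w) w; rewrite subrK; lra. Qed.

Lemma cabs_sum (I : Type) (s : seq I) (P : pred I) (F : I -> R[i]) :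
  cabs (\sum_(i <- s | P i) F i) <= \sum_(i <- s | P i) cabs (F i).
Proof.
elim/big_ind2: _ => //; first by rewrite cabs0.
by move=> z x w y hz hw; apply: le_trans (cabsD _ _) (lerD hz hw).
Qed.

Lemma cabs_real (x : R) : 0 <= x -> cabs (x%:C)%C = x.
Proof. by move=> x0; apply: complexI; rewrite -cabsE ger0_norm// ler0c. Qed.

Lemma Re_le_cabs z : complex.Re z <= cabs z.
Proof. exact: le_trans (ler_norm _) (normRe_le z). Qed.

(** The map [z |-> (1 - z)^-1] sends the unit disc to the half-plane of real part above [1 / 2].
    This keeps the terms of the test sums from cancelling. *)
Lemma Re_inv1B_ge z : cabs z < 1 -> 1 / 2 <= complex.Re (1 - z)^-1.
Proof.
case: z => a b; rewrite /cabs /= => h.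
have {}h : a ^+ 2 + b ^+ 2 < 1.
  have s0 : 0 <= a ^+ 2 + b ^+ 2 by rewrite addr_ge0 ?sqr_ge0.
  have := sqr_sqrtr s0; have := sqrtr_ge0 (a ^+ 2 + b ^+ 2).
  by set r := Num.sqrt _ in h *; nra.
have p : 0 < (1 - a) ^+ 2 + (0 - b) ^+ 2 by nra.
rewrite ler_pdivlMr//; nra.
Qed.

End ComplexModulus.

(** * Sparse sequences and the Bessel weight *)

Section Sparse.
Variables (R : realType) (g : nat -> R[i]) (v : nat -> R) (q B0 : R).
Hypothesis g0 : forall n, g n != 0.
Hypothesis q1 : 1 < q.
Hypothesis gq : forall n, q <= cabs (g n.+1) / cabs (g n).
Hypothesis v0 : forall n, 0 < v n.
Hypothesis vB : forall N, \sum_(0 <= n < N) (v n / (1 + cabs (g n) ^+ 2)) <= B0.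

Local Notation G n := (cabs (g n)).

(* [c] bounds the ratio of the moduli of two points separated by a boundary
   circle of some [Omega g n] passing between them. *)
Definition ratio_bound := (q + 1) / (2 * q).
Local Notation c := ratio_bound.
Local Notation d := (1 - c).

Lemma q0 : 0 < q. Proof. exact: lt_trans ltr01 q1. Qed.

Lemma cE : 2 * q * c = q + 1.
Proof. by rewrite /ratio_bound; field; rewrite gt_eqF// q0. Qed.

Lemma c_gt0 : 0 < c.
Proof. by have := q0; rewrite /ratio_bound => h; rewrite divr_gt0//; lra. Qed.

Lemma d_gt0 : 0 < d.
Proof.
have := cE; have := q1; have := q0 => h0 h1 hc.
have : 0 < 2 * q * d by lra.
by rewrite pmulr_rgt0//; lra.
Qed.

Lemma G_gt0 n : 0 < G n. Proof. by rewrite cabs_gt0. Qed.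

Lemma G_step n : q * G n <= G n.+1.
Proof. by rewrite -ler_pdivlMr ?G_gt0. Qed.

Lemma G_le m n : (m <= n)%N -> G m <= G n.
Proof.
elim: n => [|n IH]; first by rewrite leqn0 => /eqP->.
rewrite leq_eqVlt => /predU1P[->//|/IH h].
apply: le_trans h _; apply: le_trans (G_step n).
by rewrite ler_peMl ?(ltW q1)// cabs_ge0.
Qed.

Lemma G_lt m n : (m < n)%N -> q * G m <= G n.
Proof. by move=> mn; apply: le_trans (G_step m) (G_le mn). Qed.

Lemma G_exp n : G 0%N * q ^+ n <= G n.
Proof.
elim: n => [|n IH]; first by rewrite expr0 mulr1.
apply: le_trans (G_step n); rewrite exprS mulrCA ler_wpM2l// ltW//; exact: q0.
Qed.

Lemma Omega_low n z j : Omega g n z -> (j < n)%N -> G j <= c * cabs z.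
Proof.
case: n => // n [h _]; rewrite ltnS => /G_le jn.
have h1 := G_step n.
have : G n * (q + 1) <= 2 * cabs z by lra.
rewrite -cE => h2.
have h3 : G n * (q * c) <= cabs z by lra.
have c0 := c_gt0; have h0 := q0.
(* This is [(q + 1)^2 >= 4 q]. Below the annulus the ratio that comes out is
   [2 / (q + 1) = 1 / (q * c)]; it is weakened to [c] so that one constant serves both sides. *)
have c1 : 1 <= q * c ^+ 2 * 1.
  have : (2 * q * c) ^+ 2 = (q + 1) ^+ 2 by rewrite cE.
  have : 0 <= (q - 1) ^+ 2 by exact: sqr_ge0.
  have -> : (2 * q * c) ^+ 2 = 4 * q * (q * c ^+ 2) by ring.
  have := q0 => h1' h2' h3' ; rewrite mulr1 -(ler_pM2l (x := 4 * q)); last by lra.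
  by lra.
have h4 : G n * (q * c) * c <= cabs z * c by apply: ler_wpM2r => //; lra.
have : G n * 1 <= G n * (q * c ^+ 2 * 1) by apply: ler_wpM2l => //; exact: ltW (G_gt0 _).
have -> : G n * (q * c ^+ 2 * 1) = G n * (q * c) * c by ring.
lra.
Qed.

Lemma Omega_ub n z : Omega g n z -> 2 * cabs z < G n + G n.+1.
Proof. by case: n => [h|n [_ h]]; rewrite /= in h; lra. Qed.

Lemma Omega_lb n z : Omega g n.+1 z -> G n + G n.+1 <= 2 * cabs z.
Proof. by case=> h _; lra. Qed.

Lemma Omega_up n z j : Omega g n z -> (n < j)%N -> cabs z <= c * G j.
Proof.
move=> /Omega_ub h nj; have h1 := G_le nj; have h2 := G_step n.
have h3 : 2 * q * cabs z <= (q + 1) * G j.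
  have : q * (2 * cabs z) <= q * (G n + G n.+1) by apply: ler_wpM2l; [exact: ltW q0|lra].
  have : q * G n.+1 <= q * G j by apply: ler_wpM2l => //; exact: ltW q0.
  lra.
rewrite -cE in h3.
have : 2 * q * cabs z <= 2 * q * (c * G j) by lra.
by rewrite ler_pM2l//; have := q0; lra.
Qed.

Lemma Omega_disj m n z : (m < n)%N -> Omega g m z -> Omega g n z -> False.
Proof.
case: n => // n; rewrite ltnS => mn /Omega_ub h1 /Omega_lb h2.
by have := G_le mn; have := @G_le m.+1 n.+1 mn; lra.
Qed.

Lemma Omega_inj m n z : Omega g m z -> Omega g n z -> m = n.
Proof.
move=> h1 h2; have [mn|nm|//] := ltngtP m n.
  by case: (Omega_disj mn h1 h2).
by case: (Omega_disj nm h2 h1).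
Qed.

Lemma Omega_exists z : exists n, Omega g n z.
Proof.
have ex : exists n, cabs z < (G n + G n.+1) / 2.
  have [n nE] := expr_unbounded (cabs z / G 0%N) q1; exists n.
  rewrite ltr_pdivrMr ?G_gt0// mulrC in nE.
  by have := lt_le_trans nE (G_exp n); have := @G_le n n.+1 (leqnSn _); lra.
case: (ex_minnP ex) => -[|n] h nmin; first by exists 0%N.
exists n.+1; split => //; rewrite leNgt; apply/negP => /nmin.
by rewrite ltnn.
Qed.

Definition level z : nat := xget 0%N [set n | Omega g n z].

Lemma Omega_level z : Omega g (level z) z.
Proof. by have [n nE] := Omega_exists z; rewrite /level; case: xgetP => [m _ //|/(_ n)]. Qed.

Lemma level_eq n z : Omega g n z -> level z = n.
Proof. exact/Omega_inj/Omega_level. Qed.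

Lemma level_far a b : ((level a).+1 < level b)%N -> q * cabs a <= cabs b.
Proof.
move=> ab; have := Omega_level b; have h1 := Omega_ub (Omega_level a).
case: (level b) ab => // n an /Omega_lb h2.
have h3 : q * G (level a) <= G n by exact: G_lt.
have h4 : q * G (level a).+1 <= G n.+1 by apply: G_lt; apply: leq_trans an _.
have : q * (2 * cabs a) <= q * (G (level a) + G (level a).+1).
  by apply: ler_wpM2l; [exact: ltW q0|exact: ltW].
lra.
Qed.

Lemma level_gt0_cabs z : (0 < level z)%N -> 0 < cabs z.
Proof.
have := Omega_level z; case: (level z) => // n /Omega_lb.
by have := G_gt0 n; have := G_gt0 n.+1; lra.
Qed.

Lemma dist_low z j : (j < level z)%N ->
  d * cabs z <= cabs (z - g j) <= 2 * cabs z.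
Proof.
move=> /(Omega_low (Omega_level z)) h.
have h1 := cabsB_ge z (g j); have h2 := cabsB z (g j).
have := d_gt0; have := cabs_ge0 z => z0 d0.
apply/andP; split; first by lra.
apply: le_trans h2 _; have : c * cabs z <= 1 * cabs z by apply: ler_wpM2r => //; lra.
lra.
Qed.

Lemma dist_up z j : (level z < j)%N -> d * G j <= cabs (z - g j) <= 2 * G j.
Proof.
move=> /(Omega_up (Omega_level z)) h.
rewrite cabsBC; have h1 := cabsB_ge (g j) z; have h2 := cabsB (g j) z.
have := d_gt0; have := G_gt0 j => z0 d0.
apply/andP; split; first by lra.
apply: le_trans h2 _; have : c * G j <= 1 * G j by apply: ler_wpM2r; lra.
lra.
Qed.

Local Notation P := (Pseq g v).
Local Notation p j := (v j / G j ^+ 2).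

Lemma p_gt0 j : 0 < p j.
Proof. by rewrite divr_gt0// exprn_gt0// G_gt0. Qed.

Lemma p_ge0 j : 0 <= p j.
Proof. exact/ltW/p_gt0. Qed.

(** The factor is the largest value of [(1 + G j ^+ 2) / G j ^+ 2], attained at [j = 0]; it passes
    from the assumed series to that of [p]. *)
Definition Pbound := (1 + (G 0%N ^+ 2)^-1) * B0.

Lemma p_partial m N : \sum_(m <= j < N) p j <= Pbound.
Proof.
have [Nm|mN] := leqP N m.
  rewrite big_geq//; apply: mulr_ge0.
    by rewrite addr_ge0// invr_ge0 sqr_ge0.
  by have := vB 0; rewrite big_geq.
apply: (@le_trans _ _ (\sum_(0 <= j < N) p j)).
  rewrite [X in _ <= X](big_cat_nat (leq0n m) (ltnW mN)) /= lerDr.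
  by apply: sumr_ge0 => j _; exact: p_ge0.
apply: le_trans (ler_wpM2l _ (vB N)); last by rewrite addr_ge0// invr_ge0 sqr_ge0.
rewrite mulr_sumr; apply: ler_sum => j _.
have h0 : 0 < G 0%N ^+ 2 by rewrite exprn_gt0// G_gt0.
have hj : G 0%N ^+ 2 <= G j ^+ 2 by rewrite ler_sqr ?nnegrE ?cabs_ge0// G_le.
have hj0 : 0 < G j ^+ 2 by exact: lt_le_trans hj.
rewrite mulrCA; apply: ler_wpM2l; first exact: ltW.
rewrite ler_pdivlMr; last by lra.
set x := G j ^+ 2 in hj hj0 *; set y := G 0%N ^+ 2 in h0 hj *.
have -> : x^-1 * (1 + x) = 1 + x^-1 by rewrite mulrDr mulr1 mulVf ?gt_eqF// addrC.
by rewrite lerD2l lef_pV2.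
Qed.

Lemma P_ge n N : \sum_(n.+1 <= j < N) p j <= P n.
Proof. exact: (nnseries_ge p_ge0 (@p_partial n.+1)). Qed.

Lemma P_le n B : (forall N, \sum_(n.+1 <= j < N) p j <= B) -> P n <= B.
Proof. exact: (nnseries_le p_ge0 (@p_partial n.+1)). Qed.

Lemma P_split n m : (n <= m)%N -> P n = \sum_(n.+1 <= j < m.+1) p j + P m.
Proof.
move=> nm; apply/eqP; rewrite eq_le; apply/andP; split.
  apply: P_le => N; have [Nm|mN] := leqP N m.+1.
    have h : \sum_(m.+1 <= j < N) p j <= P m by exact: P_ge.
    rewrite big_geq// in h.
    have [Nn|nN] := leqP N n.+1.
      rewrite big_geq// addr_ge0//; apply: sumr_ge0 => j _; exact: p_ge0.
    rewrite [X in _ <= X + _](big_cat_nat (ltnW nN) Nm) /= -addrA lerDl addr_ge0//.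
    by apply: sumr_ge0 => j _; exact: p_ge0.
  rewrite (big_cat_nat (n := m.+1)) ?ltnS//=; last exact: ltnW.
  by rewrite lerD2l P_ge.
rewrite -lerBrDl; apply: P_le => N; rewrite lerBrDl.
have [Nm|mN] := leqP N m.+1; first by rewrite [X in _ + X]big_geq// addr0 P_ge.
by rewrite -big_cat_nat ?ltnS ?P_ge//=; exact: ltnW.
Qed.

Lemma P_ge0 n : 0 <= P n.
Proof. by have := P_ge n 0; rewrite big_geq. Qed.

Lemma P_gt0 n : 0 < P n.
Proof.
rewrite (@P_split n n.+1)// big_nat1.
by have := p_gt0 n.+1; have := P_ge0 n.+1; lra.
Qed.

Lemma P_lt m n : (m < n)%N -> P n < P m.
Proof.
move=> mn; rewrite (P_split (ltnW mn)) big_nat_recr//=.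
have := p_gt0 n.
have : 0 <= \sum_(m.+1 <= j < n) p j by apply: sumr_ge0 => j _; exact: p_ge0.
lra.
Qed.

Lemma P_anti m n : (m <= n)%N -> P n <= P m.
Proof. by rewrite leq_eqVlt => /predU1P[->//|/P_lt/ltW]. Qed.

(** Vanishes at [n = 0], where [Vseq] is [1]. The splitting of the sums produces [W]; the two agree
    on positive levels ([VseqW]). *)
Local Notation W n := (\sum_(j < n) v j).

Lemma W_ge0 n : 0 <= W n.
Proof. by apply: sumr_ge0 => j _; exact: ltW. Qed.

Lemma W_lt m n : (m < n)%N -> W m < W n.
Proof.
elim: n => // n IH; rewrite ltnS leq_eqVlt => /predU1P[->|/IH h];
  by rewrite [X in _ < X]big_ord_recr /=; have := v0 n; lra.
Qed.

Lemma W_le m n : (m <= n)%N -> W m <= W n.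
Proof. by rewrite leq_eqVlt => /predU1P[->//|/W_lt/ltW]. Qed.

Lemma Vseq_gt0 n : 0 < Vseq v n.
Proof. by case: n => [|n]; [exact: ltr01|apply: le_lt_trans (W_ge0 0) _; exact: W_lt]. Qed.

Lemma VseqW n : (0 < n)%N -> Vseq v n = W n.
Proof. by case: n. Qed.

(** * Two-sided bounds for the weight *)

Local Notation s z j := (v j / cabs (z - g j) ^+ 2).

Lemma s_ge0 z j : 0 <= s z j.
Proof. by rewrite divr_ge0 ?sqr_ge0// ltW. Qed.

Lemma s_low z j : (j < level z)%N ->
  v j / (4 * cabs z ^+ 2) <= s z j <= v j / (d ^+ 2 * cabs z ^+ 2).
Proof.
move=> jz; have z0 := level_gt0_cabs (leq_ltn_trans (leq0n _) jz).
have /andP[h1 h2] := dist_low jz.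
have dz : 0 < d * cabs z by apply: mulr_gt0 => //; exact: d_gt0.
have e0 : 0 < cabs (z - g j) by exact: lt_le_trans h1.
have -> : 4 * cabs z ^+ 2 = (2 * cabs z) ^+ 2 by ring.
rewrite -exprMn; apply/andP; split; rewrite ler_wpM2l ?(ltW (v0 _))//;
  rewrite lef_pV2 ?posrE ?exprn_gt0 ?ler_sqr ?nnegrE//; lra.
Qed.

Lemma s_up z j : (level z < j)%N -> p j / 4 <= s z j <= p j / d ^+ 2.
Proof.
move=> jz; have z0 := G_gt0 j.
have /andP[h1 h2] := dist_up jz.
have dz : 0 < d * G j by apply: mulr_gt0 => //; exact: d_gt0.
have e0 : 0 < cabs (z - g j) by exact: lt_le_trans h1.
rewrite -!mulrA -!invfM.
have -> : G j ^+ 2 * 4 = (2 * G j) ^+ 2 by ring.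
rewrite [G j ^+ 2 * _]mulrC -exprMn; apply/andP; split; rewrite ler_wpM2l ?(ltW (v0 _))//;
  rewrite lef_pV2 ?posrE ?exprn_gt0 ?ler_sqr ?nnegrE//; lra.
Qed.

Lemma big_split3 (u : nat -> R) n N : (n < N)%N ->
  \sum_(0 <= j < N) u j = \sum_(j < n) u j + u n + \sum_(n.+1 <= j < N) u j.
Proof.
move=> nN; rewrite (big_cat_nat (n := n)) ?(ltnW nN)//= big_mkord.
by rewrite [X in _ + X = _](big_cat_nat (n := n.+1))//= big_nat1 addrA.
Qed.

Definition weight_inv z := \big[+%R/0]_(0 <= j <oo) s z j.
Local Notation S := weight_inv.

(** The series split at the level of [z], with the distances replaced by their lower bounds
    [d * cabs z] for smaller indices and [d * G j] for larger ones; the diagonal term is kept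
    exact. *)
Definition S_up z := (W (level z) / cabs z ^+ 2 + P (level z)) / d ^+ 2 + s z (level z).

Lemma s_partial z N : \sum_(0 <= j < N) s z j <= S_up z.
Proof.
have key M : (level z < M)%N -> \sum_(0 <= j < M) s z j <= S_up z.
  move=> zN; rewrite (big_split3 _ zN) addrAC lerD2r mulrDl lerD//.
    rewrite -mulrA -invfM mulr_suml; apply: ler_sum => j _.
    by have /andP[_] := s_low (ltn_ord j); rewrite [_ ^+ 2 * d ^+ 2]mulrC.
  apply: (@le_trans _ _ ((\sum_((level z).+1 <= j < M) p j) / d ^+ 2)).
    rewrite mulr_suml [X in X <= _]big_nat [X in _ <= X]big_nat; apply: ler_sum => j /andP[zj _].
    by have /andP[_] := s_up zj.
  by rewrite ler_wpM2r ?invr_ge0 ?sqr_ge0// P_ge.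
have [/key//|Nz] := ltnP (level z) N.
apply: le_trans (key (level z).+1 (ltnSn _)).
rewrite [X in _ <= X](big_cat_nat (leq0n N)) ?(leq_trans Nz)//= lerDl.
by apply: sumr_ge0 => j _; exact: s_ge0.
Qed.

Lemma S_ge z N : \sum_(0 <= j < N) s z j <= S z.
Proof. exact: (nnseries_ge (s_ge0 z) (s_partial z)). Qed.

Lemma S_le z : S z <= S_up z.
Proof. exact: (nnseries_le (s_ge0 z) (s_partial z) (s_partial z)). Qed.

(** The [4] is the square of the factor [2] in the upper bounds of [dist_low] and [dist_up]. *)
Lemma S_ge_three z :
  W (level z) / (4 * cabs z ^+ 2) + s z (level z) + P (level z) / 4 <= S z.
Proof.
set n := level z.
suff h : P n <= 4 * (S z - (W n / (4 * cabs z ^+ 2) + s z n)) by lra.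
apply: P_le => N; rewrite -ler_pdivrMl ?ltr0n// lerBrDl.
have [Nn|nN] := leqP N n.
  rewrite big_geq ?mulr0 ?addr0; last exact: leq_trans Nn _.
  apply: le_trans (S_ge z n.+1); rewrite big_nat_recr//= lerD2r big_mkord mulr_suml.
  by apply: ler_sum => j _; have /andP[] := s_low (ltn_ord j).
apply: le_trans (S_ge z N); rewrite (big_split3 _ nN); apply: lerD.
  rewrite lerD2r mulr_suml.
  by apply: ler_sum => j _; have /andP[] := s_low (ltn_ord j).
rewrite mulr_sumr [X in X <= _]big_nat [X in _ <= X]big_nat.
by apply: ler_sum => j /andP[nj _]; have /andP[] := s_up nj; rewrite mulrC.
Qed.

Lemma S_gt0 z : 0 < S z.
Proof.
apply: lt_le_trans (S_ge_three z); have := P_gt0 (level z); have := s_ge0 z (level z).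
have : 0 <= W (level z) / (4 * cabs z ^+ 2).
  by rewrite divr_ge0 ?W_ge0// mulr_ge0 ?sqr_ge0.
lra.
Qed.

Local Notation w := (bessel_weight g v).

Lemma weightE z : w z = (S z)^-1.
Proof. by []. Qed.

Lemma w_gt0 z : 0 < w z.
Proof. by rewrite weightE invr_gt0 S_gt0. Qed.

Lemma w_ge0 z : 0 <= w z.
Proof. exact/ltW/w_gt0. Qed.

Lemma w_le z x : 0 < x -> x <= S z -> w z <= x^-1.
Proof. by move=> x0 xS; rewrite weightE lef_pV2 ?posrE// S_gt0. Qed.

Lemma w_leP z : w z <= 4 / P (level z).
Proof.
have -> : 4 / P (level z) = (P (level z) / 4)^-1 by rewrite invf_div.
apply: w_le; first by rewrite divr_gt0 ?P_gt0.
apply: le_trans (S_ge_three z); rewrite lerDr addr_ge0 ?s_ge0//.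
by rewrite divr_ge0 ?W_ge0// mulr_ge0 ?sqr_ge0.
Qed.

Lemma w_leW z : (0 < level z)%N -> w z / cabs z ^+ 2 <= 4 / W (level z).
Proof.
move=> lz; have z0 := level_gt0_cabs lz.
have W0 : 0 < W (level z) by rewrite -VseqW// Vseq_gt0.
rewrite ler_pdivrMr ?exprn_gt0//.
have -> : 4 / W (level z) * cabs z ^+ 2 = (W (level z) / (4 * cabs z ^+ 2))^-1.
  by field; rewrite !gt_eqF.
apply: w_le; first by rewrite divr_gt0// mulr_gt0// exprn_gt0.
apply: le_trans (S_ge_three z); rewrite -addrA lerDl addr_ge0 ?s_ge0//.
by rewrite divr_ge0 ?P_ge0.
Qed.

Lemma w_les z n : z != g n -> w z <= cabs (z - g n) ^+ 2 / v n.
Proof.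
move=> zg; rewrite -invf_div; apply: w_le.
  by rewrite divr_gt0// exprn_gt0// cabs_gt0 subr_eq0.
apply: le_trans (S_ge z n.+1); rewrite big_nat_recr//= lerDr.
by apply: sumr_ge0 => j _; exact: s_ge0.
Qed.

(** Each point contributes at least [1] to a sum of these products, so an upper bound for such a sum
    is a bound on the number of points. *)
Lemma wS_ge1 z : 1 <= w z * S_up z.
Proof.
rewrite weightE mulrC -[X in X <= _](mulfV (x := S z)) ?gt_eqF ?S_gt0//.
by rewrite ler_wpM2r ?S_le// invr_ge0 ltW ?S_gt0.
Qed.

(** * Reduction to two Hardy inequalities *)

Variable L : set R[i].

Definition truncation_bounded (K : R) := forall (s : seq R[i]),
  uniq s -> (forall z, z \in s -> L z) -> forall (N : nat) (a : nat -> R[i]),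
  \sum_(z <- s) cabs (\sum_(0 <= j < N) a j * (v j)%:C%C / (z - g j)) ^+ 2 * w z
    <= K * \sum_(0 <= j < N) cabs (a j) ^+ 2 * v j.

Lemma l2norm_nat_finite (a : nat -> R[i]) N :
  (forall n, (N <= n)%N -> a n = 0) ->
  l2norm_nat v a = (\sum_(0 <= n < N) cabs (a n) ^+ 2 * v n)%:E.
Proof.
move=> a0; rewrite /l2norm_nat (nneseries_split 0 N) => [|k _]; last first.
  by rewrite lee_fin mulr_ge0 ?sqr_ge0// ltW.
rewrite add0n eseries0 ?adde0 ?sumEFin// => i Ni _.
by rewrite a0// cabs0 expr0n /= mul0r.
Qed.

Lemma hilbert_bounded_truncation :
  hilbert_bounded g v L w -> exists2 K, 0 <= K & truncation_bounded K.
Proof.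
(* The constant in [hilbert_bounded] carries no sign. *)
move=> [K0 hK]; exists (Num.max K0 0); first by rewrite le_max lexx orbT.
move=> s us sL N a.
pose b n := if (n < N)%N then a n else 0.
have b0 n : (N <= n)%N -> b n = 0 by rewrite /b ltnNge => ->.
have bE (f : R[i] -> nat -> R) :
    \sum_(0 <= n < N) f (a n) n = \sum_(0 <= n < N) f (b n) n.
  by rewrite !big_mkord; apply: eq_bigr => j _; rewrite /b ltn_ord.
have bEC z : \sum_(0 <= j < N) a j * (v j)%:C%C / (z - g j) = hilbert g v b z.
  rewrite /hilbert (@cvg_complex_finite _ _ N) => [|n /b0 ->]; last by rewrite !mul0r.
  by rewrite !big_mkord; apply: eq_bigr => j _; rewrite /b ltn_ord.
have nE := l2norm_nat_finite b0.
have := hK b; rewrite nE ltry => /(_ isT).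
move/(le_trans (esum_ge_seq _ us sL)); rewrite sumEFin -EFinM lee_fin.
under eq_bigr do rewrite -bEC; rewrite -(bE (fun x n => cabs x ^+ 2 * v n)).
move/le_trans; apply; apply: ler_wpM2r; last by rewrite le_max lexx.
by apply: sumr_ge0 => j _; rewrite mulr_ge0 ?sqr_ge0// ltW.
Qed.

(** The limit in [N] is taken with [s] fixed, so only [N] above all levels of [s] matter; the
    supremum over [s] comes afterwards. *)
Lemma truncation_hilbert_bounded K :
  0 <= K ->
  (forall s : seq R[i], uniq s -> (forall z, z \in s -> L z) ->
   forall (N : nat) (a : nat -> R[i]), (forall z, z \in s -> (level z < N)%N) ->
   \sum_(z <- s) cabs (\sum_(0 <= j < N) a j * (v j)%:C%C / (z - g j)) ^+ 2 * w z
     <= K * \sum_(0 <= j < N) cabs (a j) ^+ 2 * v j) ->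
  hilbert_bounded g v L w.
Proof.
move=> K0 hK; exists K => a afin.
have t0 n : 0 <= cabs (a n) ^+ 2 * v n by rewrite mulr_ge0 ?sqr_ge0// ltW.
have afn : l2norm_nat v a \is a fin_num.
  rewrite ge0_fin_numE//; apply: nneseries_ge0 => n _ _; exact: t0.
set nrm := fine (l2norm_nat v a).
have nE : l2norm_nat v a = nrm%:E by rewrite fineK.
have part N : \sum_(0 <= j < N) cabs (a j) ^+ 2 * v j <= nrm.
  rewrite -lee_fin -nE -sumEFin; apply: nneseries_lim_ge => n _ _.
  by rewrite lee_fin; exact: t0.
rewrite nE -EFinM; apply: esum_le_seq => s us sL; rewrite sumEFin lee_fin.
pose h N z := \sum_(0 <= j < N) a j * (v j)%:C%C / (z - g j).
have hcvg z : (fun N => cabs (h N z) ^+ 2 * w z) @ \oo -->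
              cabs (hilbert g v a z) ^+ 2 * w z.
  (* By the arithmetic-geometric inequality each term has modulus at most
     [|a j|^2 v j + v j / |z - g j|^2], so the series converges absolutely. *)
  have [N|hRe hIm] := @cvg_complex_series R (fun j => a j * (v j)%:C%C / (z - g j))
    (nrm + S_up z).
    apply: le_trans (lerD (part N) (s_partial z N)); rewrite -big_split /=.
    apply: ler_sum => j _; rewrite !cabsM cabsV cabs_real ?(ltW (v0 _))//.
    set x := cabs (a j); set y := (cabs (z - g j))^-1.
    rewrite -[cabs (z - g j) ^+ 2]invrK -exprVn -/y invrK.
    rewrite -subr_ge0.
    have -> : x ^+ 2 * v j + v j * y ^+ 2 - x * v j * y =
       v j * ((x - y) ^+ 2 + x ^+ 2 + y ^+ 2) / 2 by field.
    by rewrite divr_ge0// mulr_ge0 ?(ltW (v0 _))// !addr_ge0 ?sqr_ge0.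
  under eq_fun do rewrite cabs_sqr; rewrite cabs_sqr.
  apply: cvgM; last exact: cvg_cst.
  by apply: cvgD; rewrite !expr2; apply: cvgM.
have cvgs : (fun N => \sum_(z <- s) cabs (h N z) ^+ 2 * w z) @ \oo -->
            \sum_(z <- s) cabs (hilbert g v a z) ^+ 2 * w z.
  elim: (s) => [|z s' IH].
    by rewrite big_nil; under eq_fun do rewrite big_nil; exact: cvg_cst.
  by rewrite big_cons; under eq_fun do rewrite big_cons; exact: cvgD.
rewrite -(cvg_lim _ cvgs)//; apply: limr_le; first by apply: cvgP cvgs.
near=> N; apply: le_trans (hK s us sL N a _) _.
  move=> z zs; apply: (@leq_trans (\max_(t <- s) level t).+1).
    by rewrite ltnS; apply: leq_bigmax_seq.
  by near: N; exact: nbhs_infty_ge.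
by apply: ler_wpM2l => //; exact: part.
Unshelve. all: by end_near. Qed.

(** * Test sequences and the resulting conditions *)

Lemma Re_real_mul (x : R) (z : R[i]) : complex.Re (x%:C%C * z) = x * complex.Re z.
Proof. by case: z => a b /=; ring. Qed.

(* Both test sums have terms [x j / (1 - u j)] with [`|u j| < 1], whose real
   part is at least [x j / 2]. *)
Lemma cabs_sum_ge (m n : nat) (x : nat -> R) (u : nat -> R[i]) :
  (forall j, 0 <= x j) -> (forall j, (m <= j < n)%N -> cabs (u j) < 1) ->
  (\sum_(m <= j < n) x j) / 2 <= cabs (\sum_(m <= j < n) (x j)%:C%C * (1 - u j)^-1).
Proof.
move=> x0 u1; apply: le_trans (Re_le_cabs _); rewrite Re_sum mulr_suml.
rewrite [X in X <= _]big_nat [X in _ <= X]big_nat; apply: ler_sum => j jmn.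
rewrite Re_real_mul ler_wpM2l//; have := Re_inv1B_ge (u1 j jmn); lra.
Qed.

(** Multiplication by [z] turns the terms into [v j / (1 - g j / z)], with [|g j / z| < 1] for all
    [j < m] and every [z] of level at least [m]; one sequence thus tests all these points
    together. *)
Lemma test_W m z : (0 < m <= level z)%N ->
  W m / 2 <= cabs z * cabs (\sum_(0 <= j < m) 1 * (v j)%:C%C / (z - g j)).
Proof.
move=> /andP[m0 mz]; have z0 := level_gt0_cabs (leq_trans m0 mz).
have zn0 : z != 0 by rewrite -cabs_gt0.
rewrite -cabsM mulr_sumr.
have -> : \sum_(0 <= j < m) z * (1 * (v j)%:C%C / (z - g j)) =
          \sum_(0 <= j < m) (v j)%:C%C * (1 - g j / z)^-1.
  apply: eq_bigr => j _; rewrite mul1r mulrCA; congr (_ * _).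
  by rewrite -[in RHS](mulfV zn0) -mulrBl invf_div.
rewrite -(big_mkord xpredT v); apply: cabs_sum_ge => [j|j /andP[_ jm]]; first exact: ltW.
rewrite cabsM cabsV ltr_pdivrMr// mul1r.
apply: le_lt_trans (Omega_low (Omega_level z) (leq_trans jm mz)) _.
by rewrite gtr_pMl//; have := d_gt0; lra.
Qed.

(** With the coefficients [1 / conj (g j)] the terms become [- p j / (1 - z / g j)], and the squared
    norm of the sequence is again the sum of the [p j]. *)
Lemma test_P n N z : (level z <= n)%N ->
  (\sum_(n.+1 <= j < N) p j) / 2 <=
  cabs (\sum_(n.+1 <= j < N) g j * ((G j ^+ 2)^-1)%:C%C * (v j)%:C%C / (z - g j)).
Proof.
move=> zn; rewrite -cabsN -sumrN.
have -> : \sum_(n.+1 <= j < N) - (g j * ((G j ^+ 2)^-1)%:C%C * (v j)%:C%C / (z - g j)) =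
          \sum_(n.+1 <= j < N) (p j)%:C%C * (1 - z / g j)^-1.
  apply: eq_bigr => j _; rewrite -mulrN -invrN opprB -(mulrA (g j)) -rmorphM /=.
  rewrite mulrAC [RHS]mulrC [_^-1 * v j]mulrC; congr (_ * _).
  by rewrite -[in RHS](mulfV (g0 j)) -mulrBl invf_div.
apply: cabs_sum_ge => [j|j /andP[nj _]]; first exact: p_ge0.
rewrite cabsM cabsV ltr_pdivrMr ?G_gt0// mul1r.
apply: le_lt_trans (Omega_up (Omega_level z) (leq_ltn_trans zn nj)) _.
by rewrite gtr_pMl ?G_gt0//; have := d_gt0; lra.
Qed.

Definition V_condition (K : R) := forall (s : seq R[i]),
  uniq s -> (forall z, z \in s -> L z) -> forall m, (0 < m)%N ->
  W m * (\sum_(z <- s | (m <= level z)%N) w z / cabs z ^+ 2) <= K.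

Definition P_condition (K : R) := forall (s : seq R[i]),
  uniq s -> (forall z, z \in s -> L z) -> forall m,
  P m * (\sum_(z <- s | (level z <= m)%N) w z) <= K.

(** Each summand is at most [1], its second factor being one term of the series that [w] inverts; a
    bound on the number of points per annulus therefore implies this condition. *)
Definition diagonal_condition (K : R) := forall (s : seq R[i]),
  uniq s -> (forall z, z \in s -> L z) -> forall m,
  \sum_(z <- s | level z == m) w z * (v m / cabs (z - g m) ^+ 2) <= K.

(** [X] is both the squared norm of the test sequence and twice the lower bound for its transform,
    so one factor [X] cancels. *)
Lemma test_cancel (X S0 K : R) : 0 <= X -> 0 <= S0 -> 0 <= K ->
  (X / 2) ^+ 2 * S0 <= K * X -> X * S0 <= 4 * K.
Proof.
move=> X0 S00 K0 h; have [->|Xn] := eqVneq X 0; first by rewrite mul0r mulr_ge0.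
have Xp : 0 < X by rewrite lt_def Xn.
rewrite -(ler_pM2l Xp); lra.
Qed.

Lemma truncation_V K : 0 <= K -> truncation_bounded K -> V_condition (4 * K).
Proof.
move=> K0 hK s us sL m m0; apply: test_cancel => //; first exact: W_ge0.
  by apply: sumr_ge0 => z _; rewrite divr_ge0 ?sqr_ge0// w_ge0.
have := hK [seq z <- s | (m <= level z)%N] (filter_uniq _ us) _ m (fun=> 1).
rewrite big_filter => h.
have {}h := h (fun z => fun zs => sL z (mem_subseq (filter_subseq _ _) zs)).
have -> : K * W m = K * \sum_(0 <= j < m) cabs (1 : R[i]) ^+ 2 * v j.
  congr (_ * _); rewrite big_mkord; apply: eq_bigr => j _.
  by rewrite -[1]/(1%:C%C) cabs_real// expr1n mul1r.
apply: le_trans h; rewrite mulr_sumr; apply: ler_sum => z mz.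
have z0 := level_gt0_cabs (leq_trans m0 mz).
rewrite mulrA mulrAC; apply: ler_wpM2r; first exact: w_ge0.
rewrite ler_pdivrMr ?exprn_gt0// mulrC -exprMn ler_sqr ?nnegrE.
- by rewrite mulrC [X in _ <= X]mulrC; apply: test_W; rewrite m0.
- by rewrite mulr_ge0 ?invr_ge0 ?W_ge0.
- by rewrite mulr_ge0 ?cabs_ge0.
Qed.

Lemma truncation_P K : 0 <= K -> truncation_bounded K -> P_condition (4 * K).
Proof.
move=> K0 hK s us sL m.
have S0 : 0 <= \sum_(z <- s | (level z <= m)%N) w z.
  by apply: sumr_ge0 => z _; exact: w_ge0.
have [S00|Sn0] := eqVneq (\sum_(z <- s | (level z <= m)%N) w z) 0.
  by rewrite S00 mulr0 mulr_ge0.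
have Sp : 0 < \sum_(z <- s | (level z <= m)%N) w z by rewrite lt_def Sn0.
(* [P m] is a limit, so each partial sum is tested separately, by a sequence supported on
   [m < j < N]. *)
rewrite -ler_pdivlMr//; apply: P_le => N; rewrite ler_pdivlMr//.
apply: test_cancel => //; first by apply: sumr_ge0 => j _; exact: p_ge0.
pose a j := if (m < j)%N then g j * ((G j ^+ 2)^-1)%:C%C else 0.
have := hK [seq z <- s | (level z <= m)%N] (filter_uniq _ us) _ N a.
rewrite big_filter => h.
have {}h := h (fun z => fun zs => sL z (mem_subseq (filter_subseq _ _) zs)).
have restr (V : nmodType) (F : nat -> V) (F' : nat -> V) :
    (forall j, (m < j)%N -> F j = F' j) -> (forall j, (j <= m)%N -> F j = 0) ->
    \sum_(0 <= j < N) F j = \sum_(m.+1 <= j < N) F' j.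
  move=> F1 F0; have [Nm|mN] := leqP N m.+1.
    rewrite [RHS]big_geq// big_nat big1// => j /andP[_ jN].
    by apply: F0; rewrite -ltnS; exact: leq_trans jN Nm.
  rewrite (big_cat_nat (leq0n m.+1) (ltnW mN)) /= big_nat big1 ?add0r.
    by rewrite big_nat [RHS]big_nat; apply: eq_bigr => j /andP[/F1].
  by move=> j /andP[_]; rewrite ltnS => /F0.
have aE : \sum_(0 <= j < N) cabs (a j) ^+ 2 * v j = \sum_(m.+1 <= j < N) p j.
  apply: restr => j mj; last by rewrite /a ltnNge mj cabs0 expr0n /= mul0r.
  rewrite /a mj cabsM cabs_real ?invr_ge0 ?sqr_ge0//.
  by field; rewrite gt_eqF// G_gt0.
rewrite aE in h; apply: le_trans h; rewrite mulr_sumr; apply: ler_sum => z zm.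
apply: ler_wpM2r; first exact: w_ge0.
rewrite ler_sqr ?nnegrE ?cabs_ge0//; last first.
  by rewrite divr_ge0//; apply: sumr_ge0 => j _; exact: p_ge0.
apply: le_trans (test_P N zm) _.
rewrite (restr _ _ (fun j => g j * ((G j ^+ 2)^-1)%:C%C * (v j)%:C%C / (z - g j)))//.
  by move=> j mj; rewrite /a mj.
by move=> j mj; rewrite /a ltnNge mj !mul0r.
Qed.

Lemma truncation_diagonal K : truncation_bounded K -> diagonal_condition K.
Proof.
move=> hK s us sL m.
pose a j : R[i] := if j == m then 1 else 0.
have := hK [seq z <- s | level z == m] (filter_uniq _ us) _ m.+1 a.
rewrite big_filter => h.
have {}h := h (fun z => fun zs => sL z (mem_subseq (filter_subseq _ _) zs)).
have c1 : cabs (1 : R[i]) = 1 by rewrite -[1]/(1%:C%C) cabs_real.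
have restr (V : nmodType) (F : nat -> V) : (forall j, (j < m)%N -> F j = 0) ->
    \sum_(0 <= j < m.+1) F j = F m.
  move=> F0; rewrite big_nat_recr//= big_nat big1 ?add0r// => j /andP[_]; exact: F0.
rewrite (restr _ (fun j => cabs (a j) ^+ 2 * v j)) in h; last first.
  by move=> j jm; rewrite /a ltn_eqF// cabs0 expr0n /= mul0r.
rewrite /a eqxx c1 expr1n mul1r in h.
rewrite -(ler_pM2r (v0 m)); apply: le_trans h.
rewrite mulr_suml; apply: ler_sum => z _; rewrite (restr _ (fun j => a j * _ / _)).
  rewrite /a eqxx mul1r cabsM cabsV cabs_real ?(ltW (v0 _))//.
  by rewrite exprMn exprVn le_eqVlt; apply/orP; left; apply/eqP; ring.
by move=> j jm; rewrite /a ltn_eqF// !mul0r.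
Qed.

(** * From the three conditions back to boundedness *)

Lemma sum_by_level (s : seq R[i]) N (f : nat -> R[i] -> R) :
  (forall z, z \in s -> (level z < N)%N) ->
  \sum_(z <- s) f (level z) z = \sum_(j < N) \sum_(z <- s | level z == j) f j z.
Proof.
move=> sN; under [RHS]eq_bigr do rewrite big_mkcond /=.
rewrite exchange_big /= big_seq [RHS]big_seq; apply: eq_bigr => z /sN zN.
by rewrite -big_mkcond /= (big_pred1 (Ordinal zN)).
Qed.

(** Reversing the indices below [N] turns tails into initial sums, so that one Hardy inequality
    serves both [V] and [P]. *)
Lemma sum_tail_rev (f : nat -> R) n N : (n < N)%N ->
  \sum_(n.+1 <= j < N) f j = \sum_(j < N.-1 - n) f (N.-1 - j)%N.
Proof.
move=> nN; rewrite -[n.+1]add0n big_addn big_nat_rev big_mkord /=.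
have -> : (N - n.+1 = N.-1 - n)%N by lia.
by apply: eq_bigr => j _; congr (f _); have := ltn_ord j; lia.
Qed.

Lemma cabs_truncation z N (a : nat -> R[i]) : (level z < N)%N ->
  cabs (\sum_(0 <= j < N) a j * (v j)%:C%C / (z - g j)) <=
  (\sum_(j < level z) cabs (a j) * v j) / cabs z / d +
  cabs (a (level z)) * v (level z) / cabs (z - g (level z)) +
  (\sum_((level z).+1 <= j < N) cabs (a j) * G j * p j) / d.
Proof.
move=> zN; apply: le_trans (cabs_sum _ _ _) _; rewrite (big_split3 _ zN).
have d0 := d_gt0.
have tE j : cabs (a j * (v j)%:C%C / (z - g j)) =
            cabs (a j) * v j / cabs (z - g j).
  by rewrite !cabsM cabsV cabs_real ?(ltW (v0 _)).
have a0 j : 0 <= cabs (a j) * v j by rewrite mulr_ge0 ?cabs_ge0 ?(ltW (v0 _)).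
apply: lerD; first apply: lerD; rewrite ?tE//.
  rewrite !mulr_suml; apply: ler_sum => j _; rewrite tE -!(mulrA (_ * v j)).
  have := dist_low (ltn_ord j) => /andP[h _].
  have z0 := level_gt0_cabs (leq_ltn_trans (leq0n _) (ltn_ord j)).
  apply: ler_wpM2l => //; rewrite -invfM [_ * d]mulrC lef_pV2 ?posrE ?mulr_gt0//.
  by apply: lt_le_trans h; rewrite mulr_gt0.
rewrite mulr_suml [X in X <= _]big_nat [X in _ <= X]big_nat; apply: ler_sum => j /andP[zj _].
rewrite tE; have /andP[h _] := dist_up zj; have j0 := G_gt0 j.
have -> : cabs (a j) * G j * p j / d = cabs (a j) * v j / (d * G j).
  by field; rewrite !gt_eqF.
apply: ler_wpM2l => //; rewrite lef_pV2 ?posrE ?mulr_gt0//.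
by apply: lt_le_trans h; rewrite mulr_gt0.
Qed.

Lemma conditions_truncation KV KP KD (s : seq R[i]) N (a : nat -> R[i]) :
  0 <= KV -> 0 <= KP -> V_condition KV -> P_condition KP -> diagonal_condition KD ->
  uniq s -> (forall z, z \in s -> L z) ->
  (forall z, z \in s -> (level z < N)%N) ->
  \sum_(z <- s) cabs (\sum_(0 <= j < N) a j * (v j)%:C%C / (z - g j)) ^+ 2 * w z
  <= 3 * (4 * KV / d ^+ 2 + KD + 4 * KP / d ^+ 2) *
     \sum_(0 <= j < N) cabs (a j) ^+ 2 * v j.
Proof.
move=> KV0 KP0 hV hP hD us sL sN.
have d0 := d_gt0; rewrite big_mkord.
set T := \sum_(j < N) cabs (a j) ^+ 2 * v j.
pose X z := (\sum_(j < level z) cabs (a j) * v j) / cabs z / d.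
pose Y z := cabs (a (level z)) * v (level z) / cabs (z - g (level z)).
pose Z z := (\sum_((level z).+1 <= j < N) cabs (a j) * G j * p j) / d.
have sX : \sum_(z <- s) w z * X z ^+ 2 <= 4 * KV / d ^+ 2 * T.
  have := @hardy_finite R _ s level (fun z => w z / cabs z ^+ 2) v
    (fun j => cabs (a j)) KV N.
  move=> H; have {}H := H (fun z => divr_ge0 (w_ge0 z) (sqr_ge0 _)) v0
    (fun j => cabs_ge0 _) KV0 (fun m mN => hV s us sL m (andP mN).1)
    (fun z zs => ltnW (sN z zs)).
  rewrite [X in _ <= X]mulrAC ler_pdivlMr ?exprn_gt0//; apply: le_trans H.
  rewrite mulr_suml le_eqVlt; apply/orP; left; apply/eqP; apply: eq_bigr => z _.
  rewrite /X; set A := \sum_(j < _) _; rewrite !exprMn !exprVn.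
  by rewrite -[LHS]mulrA divfK ?gt_eqF ?exprn_gt0//; ring.
have sZ : \sum_(z <- s) w z * Z z ^+ 2 <= 4 * KP / d ^+ 2 * T.
  (* Levels and masses are read backwards from [N.-1]. The masses are [p j], and [x j = |a j| G j]
     makes [x j ^+ 2 * p j] equal to [|a j|^2 v j]. *)
  have := @hardy_finite R _ s (fun z => N.-1 - level z)%N w (fun j => p (N.-1 - j)%N)
    (fun j => cabs (a (N.-1 - j)%N) * G (N.-1 - j)%N) KP N.
  have cP m : (0 < m <= N)%N -> (\sum_(j < m) p (N.-1 - j)%N) *
      \sum_(z <- s | (m <= N.-1 - level z)%N) w z <= KP.
    (* For [m = N] no point qualifies: reversed levels stay below [N]. *)
    move=> /andP[m0]; rewrite leq_eqVlt => /predU1P[->|mN].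
      rewrite [X in _ * X]big_seq_cond [X in _ * X]big_pred0 ?mulr0//.
      move=> z; apply/negbTE; apply/negP => /andP[/sN]; lia.
    have -> : \sum_(j < m) p (N.-1 - j)%N = \sum_((N.-1 - m).+1 <= j < N) p j.
      rewrite (sum_tail_rev (fun j => p j)); last lia.
      by have -> : (N.-1 - (N.-1 - m) = m)%N by lia.
    apply: le_trans (hP s us sL (N.-1 - m)%N); apply: ler_pM.
    - by apply: sumr_ge0 => j _; exact: p_ge0.
    - by apply: sumr_ge0 => z _; exact: w_ge0.
    - exact: P_ge.
    - apply: ler_sum_cond => [z zs h|z _ _]; last exact: w_ge0.
      by split=> //; lia.
  move=> H; have {}H := H w_ge0 (fun j => p_gt0 _)
    (fun j => mulr_ge0 (cabs_ge0 _) (cabs_ge0 _)) KP0 cP _.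
  have {}H := H (fun z _ => leq_trans (leq_subr _ _) (leq_pred _)).
  have TE : \sum_(j < N) (cabs (a (N.-1 - j)%N) * G (N.-1 - j)%N) ^+ 2 * p (N.-1 - j)%N = T.
    rewrite (reindex_inj rev_ord_inj) /=; apply: eq_bigr => j _.
    have -> : (N.-1 - (N - j.+1) = j)%N by have := ltn_ord j; lia.
    by field; rewrite gt_eqF// G_gt0.
  rewrite TE in H; rewrite [X in _ <= X]mulrAC ler_pdivlMr ?exprn_gt0//; apply: le_trans H.
  rewrite mulr_suml le_eqVlt; apply/orP; left; apply/eqP.
  rewrite big_seq [RHS]big_seq; apply: eq_bigr => z /sN zN.
  rewrite /Z (sum_tail_rev (fun j => cabs (a j) * G j * p j) zN); set A := \sum_(j < _) _.
  by rewrite exprMn exprVn -!mulrA mulVf ?gt_eqF ?exprn_gt0// mulr1.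
have sY : \sum_(z <- s) w z * Y z ^+ 2 <= KD * T.
  rewrite (sum_by_level (fun n z => w z *
    (cabs (a n) * v n / cabs (z - g n)) ^+ 2) sN) /T mulr_sumr.
  apply: ler_sum => j _; apply: le_trans (ler_wpM2r _ (hD s us sL j)); last first.
    by rewrite mulr_ge0 ?sqr_ge0 ?(ltW (v0 _)).
  rewrite mulr_suml le_eqVlt; apply/orP; left; apply/eqP; apply: eq_bigr => z _.
  by rewrite !exprMn exprVn; ring.
have -> : 3 * (4 * KV / d ^+ 2 + KD + 4 * KP / d ^+ 2) * T =
  3 * (4 * KV / d ^+ 2 * T + KD * T + 4 * KP / d ^+ 2 * T) by ring.
apply: (@le_trans _ _ (3 * (\sum_(z <- s) w z * X z ^+ 2 +
   \sum_(z <- s) w z * Y z ^+ 2 + \sum_(z <- s) w z * Z z ^+ 2))); last first.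
  by apply: ler_wpM2l => //; apply: lerD => //; apply: lerD.
rewrite -!big_split /= mulr_sumr big_seq [X in _ <= X]big_seq.
apply: ler_sum => z /sN zN.
have -> : 3 * (w z * X z ^+ 2 + w z * Y z ^+ 2 + w z * Z z ^+ 2) =
          3 * (X z ^+ 2 + Y z ^+ 2 + Z z ^+ 2) * w z by ring.
apply: ler_wpM2r; first exact: w_ge0.
have h : cabs (\sum_(0 <= j < N) a j * (v j)%:C%C / (z - g j)) <= X z + Y z + Z z.
  exact: cabs_truncation.
apply: (@le_trans _ _ ((X z + Y z + Z z) ^+ 2)).
  by rewrite ler_sqr ?nnegrE ?cabs_ge0//; apply: le_trans h; exact: cabs_ge0.
rewrite -subr_ge0.
have -> : 3 * (X z ^+ 2 + Y z ^+ 2 + Z z ^+ 2) - (X z + Y z + Z z) ^+ 2 =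
  (X z - Y z) ^+ 2 + (Y z - Z z) ^+ 2 + (X z - Z z) ^+ 2 by ring.
by rewrite !addr_ge0 ?sqr_ge0.
Qed.

(** * Necessity *)

Local Notation n_ z := (level z).
Local Notation Vq z := (Vseq v (n_ z) / cabs z ^+ 2).
Local Notation sq z := (v (n_ z) / cabs (z - g (n_ z)) ^+ 2).

Lemma Lam0_elim z : Lam0 g v L z ->
  [/\ L z, z != 0, Vq z <= sq z & P (n_ z) <= sq z].
Proof.
case=> Lz [n [nz]]; rewrite (level_eq nz) /qV; case: eqVneq => // z0.
by rewrite ge_max !lee_fin => /andP[].
Qed.

(** The origin can belong to [LamV], through the value [+oo] of [qV]; a positive level excludes
    it. *)
Lemma LamV_elim z : LamV g v L z -> (0 < n_ z)%N ->
  [/\ L z, sq z < Vq z & P (n_ z) < Vq z].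
Proof.
case=> Lz [n [nz]]; rewrite (level_eq nz) /qV => + n0.
have z0 : 0 < cabs z by apply: level_gt0_cabs; rewrite (level_eq nz).
case: eqVneq => [zz|_]; first by rewrite zz cabs0 ltxx in z0.
by rewrite gt_max !lte_fin => /andP[].
Qed.

Lemma LamP_elim z : LamP g v L z ->
  [/\ L z, z != 0, sq z < P (n_ z) & Vq z < P (n_ z)].
Proof.
case=> Lz [n [nz]]; rewrite (level_eq nz) /qV; case: eqVneq => [_|z0].
  by rewrite gt_max => /andP[].
by rewrite gt_max !lte_fin => /andP[].
Qed.

(* The points of level at least 1 that are in none of the three classes: the
   inequalities defining [LamV] and [LamP] are strict. *)
Definition tie z := L z /\ Vq z = P (n_ z).

Lemma classify z : L z -> (0 < n_ z)%N ->
  [\/ Lam0 g v L z, LamV g v L z, LamP g v L z | tie z].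
Proof.
move=> Lz n0; have z0 := level_gt0_cabs n0; rewrite cabs_gt0 in z0.
have [h1|h1] := leP (Num.max (Vq z) (P (n_ z))) (sq z).
  constructor 1; split=> //; exists (n_ z); split; first exact: Omega_level.
  by rewrite /qV (negbTE z0) ge_max !lee_fin -ge_max.
have [h2|h2|h2] := ltgtP (Vq z) (P (n_ z)).
- constructor 3; split=> //; exists (n_ z); split; first exact: Omega_level.
  rewrite /qV (negbTE z0) gt_max !lte_fin h2 andbT.
  by move: h1; rewrite lt_max => /orP[|//]; move/lt_trans; apply.
- constructor 2; split=> //; exists (n_ z); split; first exact: Omega_level.
  rewrite /qV (negbTE z0) gt_max !lte_fin h2 andbT.
  by move: h1; rewrite lt_max => /orP[//|]; move/lt_trans; apply.
- by constructor 4.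
Qed.

Lemma W_leV n : W n <= Vseq v n.
Proof. by case: n => [|n]; rewrite ?big_ord0. Qed.

Lemma Wq_le z : W (n_ z) / cabs z ^+ 2 <= Vq z.
Proof. by rewrite ler_wpM2r ?W_leV// invr_ge0 sqr_ge0. Qed.

(** If [y] dominates the three terms of [S_up], then [S_up <= D * y]: two terms carry [1 / d ^+ 2],
    the diagonal one carries [1]. *)
Definition dominance := 2 / d ^+ 2 + 1.
Local Notation D := dominance.

Lemma D_gt0 : 0 < D.
Proof. by rewrite addr_gt0// divr_gt0// exprn_gt0// d_gt0. Qed.

Lemma S_up_le z y : W (n_ z) / cabs z ^+ 2 <= y -> P (n_ z) <= y -> sq z <= y ->
  1 <= w z * (D * y).
Proof.
move=> h1 h2 h3; apply: le_trans (wS_ge1 z) _; apply: ler_wpM2l; first exact: w_ge0.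
have -> : D * y = 2 / d ^+ 2 * y + y by rewrite /dominance [LHS]mulrDl mul1r.
apply: lerD => //.
rewrite mulrAC ler_wpM2r ?invr_ge0 ?sqr_ge0//; lra.
Qed.

Section Necessity.
Variables (KV KP KD : R).
Hypothesis KV0 : 0 <= KV.
Hypothesis KP0 : 0 <= KP.
Hypothesis hV : V_condition KV.
Hypothesis hP : P_condition KP.
Hypothesis hD : diagonal_condition KD.

Lemma sum_ge_size (T : eqType) (s : seq T) (f : T -> R) (y : R) :
  (forall t, t \in s -> y <= f t) -> (size s)%:R * y <= \sum_(t <- s) f t.
Proof.
move=> h; apply: (@le_trans _ _ (\sum_(t <- s) y)).
  by rewrite big_const_seq iter_addr_0 count_predT mulr_natl.
by rewrite big_seq [X in _ <= X]big_seq; apply: ler_sum => t /h.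
Qed.

Definition count_bound := (KV + KP) / d ^+ 2 + KD.

(** Summing [wS_ge1] over points of the same level [n], the three parts of [S_up] become the left
    sides of the three conditions, all at the index [n]. *)
Lemma level_count_le (s : seq R[i]) n : uniq s ->
  (forall z, z \in s -> L z /\ n_ z = n) -> (size s)%:R <= count_bound.
Proof.
move=> us sLn; have sL z : z \in s -> L z by move=> /sLn[].
have sn z : z \in s -> n_ z = n by move=> /sLn[].
have := @sum_ge_size _ s (fun z => w z * S_up z) 1 (fun z _ => wS_ge1 z).
rewrite mulr1 => /le_trans; apply.
have -> : \sum_(z <- s) w z * S_up z =
  (W n * (\sum_(z <- s | (n <= n_ z)%N) w z / cabs z ^+ 2) +
  P n * (\sum_(z <- s | (n_ z <= n)%N) w z)) / d ^+ 2 +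
  \sum_(z <- s | n_ z == n) w z * (v n / cabs (z - g n) ^+ 2).
  rewrite (sum_cond_all (Q := fun z => (n <= n_ z)%N)) => [|z /sn ->]; last exact: leqnn.
  rewrite (sum_cond_all (Q := fun z => (n_ z <= n)%N)) => [|z /sn ->]; last exact: leqnn.
  rewrite (sum_cond_all (Q := fun z => n_ z == n)) => [|z /sn ->]; last exact: eqxx.
  rewrite !mulr_sumr -big_split mulr_suml -big_split /=.
  by rewrite big_seq [RHS]big_seq; apply: eq_bigr => z /sn zn; rewrite /S_up zn; ring.
rewrite /count_bound; apply: lerD; last exact: hD.
rewrite ler_wpM2r ?invr_ge0 ?sqr_ge0//; apply: lerD; last exact: hP.
case: n {sLn sn} => [|n]; first by rewrite big_ord0 mul0r.
exact: hV.
Qed.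

(** Where the [W] term dominates, each point of the block adds at least [1 / (2 * D * W m)] to a sum
    that [V_condition] bounds by [KV / W m]. *)
Lemma V_block_size (s : seq R[i]) m : uniq s -> (0 < m)%N ->
  (forall z, z \in s -> [/\ L z, (m <= n_ z)%N, W (n_ z) <= 2 * W m &
    1 <= w z * (D * (W (n_ z) / cabs z ^+ 2))]) ->
  (size s)%:R <= 2 * D * KV.
Proof.
move=> us m0 hs.
have sL z : z \in s -> L z by move=> /hs[].
have Wm : 0 < W m by rewrite -VseqW// Vseq_gt0.
have D0 := D_gt0.
have := hV us sL m0.
rewrite (sum_cond_all (Q := fun z => (m <= n_ z)%N)) => [|z /hs[]//].
have h : (size s)%:R * (2 * D * W m)^-1 <= \sum_(z <- s) w z / cabs z ^+ 2.
  apply: sum_ge_size => z /hs[_ _ W2]; set x := w z / _ => h1.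
  have E : w z * (D * (W (n_ z) / cabs z ^+ 2)) = x * D * W (n_ z) by rewrite /x; ring.
  rewrite E in h1.
  have xD0 : 0 <= x * D by rewrite mulr_ge0 ?(ltW D0)// divr_ge0 ?sqr_ge0// w_ge0.
  rewrite -[X in X <= _]mul1r ler_pdivrMr ?mulr_gt0//; apply: le_trans h1 _.
  have -> : x * (2 * D * W m) = x * D * (2 * W m) by ring.
  exact: ler_wpM2l.
move/(le_trans (ler_wpM2l (ltW Wm) h)).
have -> : W m * ((size s)%:R * (2 * D * W m)^-1) = (size s)%:R / (2 * D).
  by field; rewrite !gt_eqF.
by rewrite ler_pdivrMr ?mulr_gt0// mulrC.
Qed.

Lemma P_block_size (s : seq R[i]) m : uniq s ->
  (forall z, z \in s -> [/\ L z, (n_ z <= m)%N, P (n_ z) <= 2 * P m &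
    1 <= w z * (D * P (n_ z))]) ->
  (size s)%:R <= 2 * D * KP.
Proof.
move=> us hs.
have sL z : z \in s -> L z by move=> /hs[].
have Pm := P_gt0 m.
have D0 := D_gt0.
have := hP us sL m.
rewrite (sum_cond_all (Q := fun z => (n_ z <= m)%N)) => [|z /hs[]//].
have h : (size s)%:R * (2 * D * P m)^-1 <= \sum_(z <- s) w z.
  apply: sum_ge_size => z /hs[_ _ P2] h1.
  rewrite -[X in X <= _]mul1r ler_pdivrMr ?mulr_gt0//; apply: le_trans h1 _.
  have -> : w z * (2 * D * P m) = w z * (D * (2 * P m)) by ring.
  by apply: ler_wpM2l; [exact: w_ge0 | apply: ler_wpM2l => //; exact: ltW].
move/(le_trans (ler_wpM2l (ltW Pm) h)).
have -> : P m * ((size s)%:R * (2 * D * P m)^-1) = (size s)%:R / (2 * D).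
  by field; rewrite !gt_eqF.
by rewrite ler_pdivrMr ?mulr_gt0// mulrC.
Qed.

Lemma nat_bound (x : R) : exists M : nat, forall n : nat, n%:R <= x -> (n <= M)%N.
Proof.
exists (Num.bound `|x|) => n nx; rewrite -(ler_nat R); apply: le_trans nx _.
exact/ltW/(le_lt_trans (ler_norm _))/archi_boundP/normr_ge0.
Qed.

Lemma necessity_count : exists M : nat, forall n, atmost (L `&` Omega g n) M.
Proof.
have [M MP] := nat_bound count_bound; exists M => n.
apply/atmostP => s us sA; apply/MP/(level_count_le (n := n)) => // z /sA[Lz zn].
by split=> //; exact: level_eq.
Qed.

Lemma dyadic_double (k : int) : (2 : R) ^ (k + 1) = 2 * (2 : R) ^ k.
Proof. by rewrite expfzDr ?pnatr_eq0// expr1z mulrC. Qed.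

Lemma necessity_V : V_lacunary g v (LamV g v L).
Proof.
have [M MP] := nat_bound (count_bound + 2 * D * KV); exists M => k.
apply/atmostP => s us sA; apply: MP.
(* On level 0 [Vseq] is [1] but [W] is [0], so that annulus is left to the bound for a single
   level. *)
rewrite -(count_predC (fun z => n_ z == 0%N) s) natrD; apply: lerD.
  rewrite -size_filter; apply: (level_count_le (n := 0%N)); first exact: filter_uniq.
  by move=> z; rewrite mem_filter => /andP[/eqP z0 /sA[[Lz _] _]].
rewrite -size_filter; set t := [seq z <- s | _].
have [->|/eqP t0] := eqVneq t [::].
  by rewrite mulr_ge0// mulr_ge0// ltW// D_gt0.
have [a] := exists_argmin_seq level t0; rewrite mem_filter -lt0n => /andP[a0 as_] amin.
apply: (V_block_size (m := n_ a)); [exact: filter_uniq|exact: a0|].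
move=> z zt; have az := amin z zt; have z0 := leq_trans a0 az.
have dya y : y \in s -> (2 : R) ^ k <= Vseq v (n_ y) <= (2 : R) ^ (k + 1).
  by move=> /sA[_ [m mk ym]]; rewrite (level_eq ym).
move: zt; rewrite mem_filter => /andP[_ zs].
have [Vz _] := sA z zs; have [Lz h1 h2] := LamV_elim Vz z0.
split=> //.
  rewrite -!VseqW//; have /andP[_] := dya z zs; have /andP[+ _] := dya a as_.
  rewrite dyadic_double; lra.
rewrite VseqW// in h1 h2.
by apply: S_up_le => //; exact: ltW.
Qed.

Lemma necessity_P : P_lacunary g v (LamP g v L).
Proof.
have [M MP] := nat_bound (2 * D * KP); exists M => k.
apply/atmostP => s us sA; apply: MP.
have [->|/eqP t0] := eqVneq s [::].
  by rewrite mulr_ge0// mulr_ge0// ltW// D_gt0.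
(* [P_condition] sums over the levels up to [m], so the block is measured from its highest point,
   not from its lowest. *)
have [a as_ amax] := exists_argmax_seq level t0.
apply: (P_block_size (m := n_ a)) => // z zs; have za := amax z zs.
have dya y : y \in s -> (2 : R) ^ (- k - 1) <= P (n_ y) <= (2 : R) ^ (- k).
  by move=> /sA[_ [m mk ym]]; rewrite (level_eq ym).
have [Pz _] := sA z zs; have [Lz _ h1 h2] := LamP_elim Pz.
split=> //.
  have /andP[_] := dya z zs; have /andP[+ _] := dya a as_.
  rewrite -[- k in X in _ -> _ <= X -> _](subrK 1) dyadic_double; lra.
apply: S_up_le => //; last exact: ltW.
exact: le_trans (Wq_le z) (ltW h2).
Qed.

(** On [Lam0] the diagonal term dominates. Together with [w_les] this makes [w] comparable with the
    terms of the displayed supremum. *)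
Lemma Lam0_weight z : Lam0 g v L z -> z != g (n_ z) ->
  cabs (z - g (n_ z)) ^+ 2 / v (n_ z) <= D * w z.
Proof.
move=> /Lam0_elim[_ _ h1 h2] zg.
have := S_up_le (le_trans (Wq_le z) h1) h2 (lexx _).
have e0 : 0 < cabs (z - g (n_ z)) by rewrite cabs_gt0 subr_eq0.
have -> : w z * (D * sq z) = (D * w z) / (cabs (z - g (n_ z)) ^+ 2 / v (n_ z)).
  by field; rewrite !gt_eqF.
by rewrite ler_pdivlMr ?mul1r// divr_gt0// exprn_gt0.
Qed.

End Necessity.

(** * The condition on [Lam0] *)

(** The annuli are disjoint and cover the plane, so the double sums become sums over points, which
    reduce to finite lists. *)
Lemma esum_levels (A : set R[i]) (J : set nat) (F : nat -> R[i] -> R) :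
  (forall n z, 0 <= F n z) ->
  \esum_(m in J) \esum_(l in A `&` Omega g m) (F m l)%:E =
  \esum_(l in A `&` [set l | J (n_ l)]) (F (n_ l) l)%:E.
Proof.
move=> F0.
transitivity (\esum_(m in J) \esum_(l in A `&` Omega g m) (F (n_ l) l)%:E).
  apply: eq_esum => m _; apply: eq_esum => l [_ lm]; by rewrite (level_eq lm).
rewrite -esum_bigcupT.
- congr (esum _ _); apply/seteqP; split=> l /=.
    by case=> m Jm [Al lm]; split=> //; rewrite (level_eq lm).
  by case=> Al Jl; exists (n_ l) => //; split=> //; exact: Omega_level.
- by move=> m n _ _ [l [[_ lm] [_ ln]]]; exact: Omega_inj lm ln.
- by move=> l; rewrite lee_fin.
Qed.

Local Notation FV m l := (cabs (l - g m) ^+ 2 / (v m * cabs l ^+ 2)).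
Local Notation FP m l := (cabs (l - g m) ^+ 2 / v m).

Lemma FV_ge0 m l : 0 <= FV m l.
Proof. by rewrite divr_ge0 ?sqr_ge0// mulr_ge0 ?sqr_ge0// ltW. Qed.

Lemma FP_ge0 m l : 0 <= FP m l.
Proof. by rewrite divr_ge0 ?sqr_ge0// ltW. Qed.

Lemma FV_FP m l : FV m l = FP m l / cabs l ^+ 2.
Proof. by rewrite invfM mulrA. Qed.

Hypothesis Lg : forall l n, L l -> l != g n.

Lemma Lam0_sum_high KV (s : seq R[i]) m : V_condition KV -> uniq s ->
  (forall z, z \in s -> Lam0 g v L z /\ (m <= n_ z)%N) -> (0 < m)%N ->
  Vseq v m * \sum_(z <- s) FV (n_ z) z <= D * KV.
Proof.
move=> hV us hs m0; rewrite VseqW//.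
have sL z : z \in s -> L z by move=> /hs[[]].
have := hV s us sL m m0.
rewrite (sum_cond_all (Q := fun z => (m <= n_ z)%N)) => [|z /hs[]//].
move/(ler_wpM2l (ltW D_gt0)) => /(le_trans _); apply.
rewrite mulrCA ler_wpM2l ?W_ge0// mulr_sumr big_seq [X in _ <= X]big_seq.
apply: ler_sum => z zs; rewrite FV_FP mulrA ler_wpM2r ?invr_ge0 ?sqr_ge0//.
by apply: Lam0_weight; [exact: (hs z zs).1|exact/Lg/sL].
Qed.

Lemma Lam0_sum_low KP (s : seq R[i]) m : P_condition KP -> uniq s ->
  (forall z, z \in s -> Lam0 g v L z /\ (n_ z <= m)%N) ->
  P m * \sum_(z <- s) FP (n_ z) z <= D * KP.
Proof.
move=> hP us hs.
have sL z : z \in s -> L z by move=> /hs[[]].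
have := hP s us sL m.
rewrite (sum_cond_all (Q := fun z => (n_ z <= m)%N)) => [|z /hs[]//].
move/(ler_wpM2l (ltW D_gt0)) => /(le_trans _); apply.
rewrite mulrCA ler_wpM2l ?P_ge0// mulr_sumr big_seq [X in _ <= X]big_seq.
apply: ler_sum => z zs.
by apply: Lam0_weight; [exact: (hs z zs).1|exact/Lg/sL].
Qed.

Definition Lam0_condition (K : R) := forall n : nat,
  ((Vseq v n)%:E *
     (\esum_(m in [set m | (n <= m)%N])
        \esum_(l in Lam0 g v L `&` Omega g m) (FV m l)%:E)
   + (P n)%:E *
     (\esum_(m in [set m | (m <= n)%N])
        \esum_(l in Lam0 g v L `&` Omega g m) (FP m l)%:E)
   <= K%:E)%E.

Lemma mule_esum_le (A : set R[i]) (f : R[i] -> R) (x C : R) : 0 < x ->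
  (forall s : seq R[i], uniq s -> (forall z, z \in s -> A z) ->
     x * \sum_(z <- s) f z <= C) ->
  (x%:E * (\esum_(l in A) (f l)%:E) <= C%:E)%E.
Proof.
move=> x0 h; have -> : C%:E = (x%:E * (C / x)%:E)%E.
  by rewrite -EFinM mulrC divfK// gt_eqF.
rewrite lee_pmul2l// ?lte_fin//; apply: esum_le_seq => s us sA.
by rewrite sumEFin lee_fin ler_pdivlMr// mulrC; exact: h.
Qed.

Lemma necessity_Lam0 KV KP KD : 0 <= KV ->
  V_condition KV -> P_condition KP -> diagonal_condition KD ->
  exists K, Lam0_condition K.
Proof.
move=> KV0 hV hP hD; have D0 := D_gt0.
have C0 : 0 <= count_bound KV KP KD by apply: (level_count_le KV0 hV hP hD (s := [::]) (n := 0%N)).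
have W1 : 0 < Vseq v 1 by exact: Vseq_gt0.
have T0 : 0 <= D * KV / Vseq v 1 by rewrite divr_ge0 ?(ltW W1)// mulr_ge0// ltW.
exists ((D * KV + count_bound KV KP KD + D * KV / Vseq v 1) + D * KP) => n.
rewrite (esum_levels _ _ FV_ge0) (esum_levels _ _ FP_ge0) EFinD.
apply: leeD; apply: mule_esum_le; rewrite ?Vseq_gt0 ?P_gt0// => s us sA; last first.
  by apply: Lam0_sum_low => // z /sA[].
case: n sA => [|n] sA.
  (* For [n = 0] the factor is [1] and [V_condition] does not apply. On level 0, membership in
     [Lam0] gives [FV <= 1], so these points are merely counted; the others are summed with
     [m = 1]. *)
  rewrite mul1r (bigID (fun z => n_ z == 0%N)) /= -addrA -[D * KV + _]addrC -addrA.
  apply: (@le_trans _ _ (count_bound KV KP KD + D * KV / Vseq v 1)); last first.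
    by rewrite lerD2l lerDl mulr_ge0// ltW.
  rewrite -big_filter -[X in _ + X]big_filter; apply: lerD.
    set t := [seq i <- s | _].
    have : (size t)%:R <= count_bound KV KP KD.
      apply: (level_count_le KV0 hV hP hD (n := 0%N)); first exact: filter_uniq.
      by move=> z; rewrite mem_filter => /andP[/eqP z0 /sA[[]]].
    apply: le_trans; rewrite -sum1_size natr_sum big_seq [X in _ <= X]big_seq.
    apply: ler_sum => z; rewrite mem_filter => /andP[/eqP z0 /sA[z0L _]].
    have [Lz zn0 h1 _] := Lam0_elim z0L; have zg := Lg (n_ z) Lz.
    have e0 : 0 < cabs (z - g (n_ z)) by rewrite cabs_gt0 subr_eq0.
    have zp : 0 < cabs z by rewrite cabs_gt0.
    have s0 : 0 < sq z by rewrite divr_gt0// exprn_gt0.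
    rewrite -(ler_pM2r s0) mul1r; apply: le_trans h1; rewrite [in Vseq _ _]z0 /=.
    by rewrite le_eqVlt; apply/orP; left; apply/eqP; field; rewrite !gt_eqF.
  rewrite ler_pdivlMr// mulrC; apply: (Lam0_sum_high hV) => //.
    exact: filter_uniq.
  by move=> z; rewrite mem_filter -lt0n => /andP[z0 /sA[]].
apply: (@le_trans _ _ (D * KV)); last by rewrite -addrA lerDl addr_ge0.
by apply: (Lam0_sum_high hV) => // z /sA[].
Qed.

(** * A drop of one sequence forces growth of the other *)

(** For [n_ a < j <= n_ b] one has [|a| <= |g j|], so these masses add to [W] at least
    [|a|^2 (P (n_ a) - P (n_ b))], hence at least [(1 - 1/ka) W (n_ a)]. The point [c] lies above
    [b] because [W (n_ b)] stops just before the mass [v (n_ b)]. The non-strict hypothesis fits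
    [LamP] and ties alike. *)
Lemma growth_W ka a b c : (n_ a < n_ b)%N -> (n_ b < n_ c)%N ->
  1 < ka -> W (n_ a) <= P (n_ a) * cabs a ^+ 2 -> ka * P (n_ b) < P (n_ a) ->
  (2 - ka^-1) * W (n_ a) <= W (n_ c).
Proof.
move=> ab bc ka1 WP kP.
have h1 : cabs a ^+ 2 * (P (n_ a) - P (n_ b)) <= W (n_ c) - W (n_ a).
  rewrite (P_split (ltnW ab)) addrK mulr_sumr.
  apply: (@le_trans _ _ (\sum_((n_ a).+1 <= j < (n_ b).+1) v j)).
    rewrite big_nat [X in _ <= X]big_nat; apply: ler_sum => j /andP[aj _].
    rewrite mulrCA -[X in _ <= X]mulr1; apply: ler_wpM2l; first exact: ltW.
    rewrite ler_pdivrMr ?exprn_gt0 ?G_gt0// mul1r ler_sqr ?nnegrE ?cabs_ge0//.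
    apply: le_trans (Omega_up (Omega_level a) aj) _.
    by rewrite ger_pMl ?G_gt0//; have := d_gt0; lra.
  rewrite lerBrDl; apply: le_trans (W_le bc).
  rewrite -[W (n_ b).+1](big_mkord xpredT).
  rewrite [X in _ <= X](big_cat_nat (n := (n_ a).+1)) ?leq0n//=; last first.
    by rewrite ltnS ltnW.
  by rewrite lerD2r big_mkord; apply: W_le.
have h2 : P (n_ b) <= ka^-1 * P (n_ a).
  by rewrite ler_pdivlMl; [exact: ltW|exact: lt_trans ltr01 ka1].
have h3 : cabs a ^+ 2 * (P (n_ a) - ka^-1 * P (n_ a)) <= cabs a ^+ 2 * (P (n_ a) - P (n_ b)).
  by apply: ler_wpM2l; [exact: sqr_ge0|rewrite lerB].
have k1 : ka^-1 < 1 by rewrite invf_lt1//; exact: lt_trans ltr01 ka1.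
have h4 : (1 - ka^-1) * W (n_ a) <= (1 - ka^-1) * (P (n_ a) * cabs a ^+ 2).
  by apply: ler_wpM2l => //; lra.
lra.
Qed.

(** The mirror image: for [n_ b <= j < n_ a] one has [|g j| <= |a|]. The point [c] lies below [b]
    because [P (n_ b)] starts just after the mass [v (n_ b)]; the positive level allows division by
    [|a|^2]. *)
Lemma growth_P ka a b c : (0 < n_ c)%N -> (n_ c < n_ b)%N -> (n_ b < n_ a)%N ->
  1 < ka -> P (n_ a) * cabs a ^+ 2 <= W (n_ a) -> ka * W (n_ b) < W (n_ a) ->
  (2 - ka^-1) * P (n_ a) <= P (n_ c).
Proof.
move=> c0 cb ba ka1 PW kW.
have a0 := level_gt0_cabs (ltn_trans c0 (ltn_trans cb ba)).
have h1 : W (n_ a) - W (n_ b) <= cabs a ^+ 2 * (P (n_ c) - P (n_ a)).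
  rewrite (P_split (ltnW (ltn_trans cb ba))) addrK mulr_sumr.
  rewrite -!(big_mkord xpredT) [X in X - _](big_cat_nat (n := n_ b)) ?leq0n ?(ltnW ba)//=.
  rewrite addrAC subrr add0r.
  apply: (@le_trans _ _ (\sum_(n_ b <= j < n_ a) cabs a ^+ 2 * p j)).
    rewrite big_nat [X in _ <= X]big_nat; apply: ler_sum => j /andP[_ ja].
    rewrite mulrCA -[X in X <= _]mulr1; apply: ler_wpM2l; first exact: ltW.
    rewrite ler_pdivlMr ?exprn_gt0 ?G_gt0// mul1r ler_sqr ?nnegrE ?cabs_ge0//.
    apply: le_trans (Omega_low (Omega_level a) ja) _.
    by rewrite ger_pMl//; have := d_gt0; lra.
  have pp j : 0 <= cabs a ^+ 2 * p j by rewrite mulr_ge0 ?sqr_ge0// p_ge0.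
  rewrite [X in _ <= X](big_cat_nat (n := n_ b)) ?(leq_trans (ltnW ba))//=.
  rewrite [X in _ <= _ + X](big_cat_nat (n := n_ a)) ?(ltnW ba)//= addrCA lerDl.
  by rewrite addr_ge0//; apply: sumr_ge0.
have h2 : W (n_ b) <= ka^-1 * W (n_ a).
  by rewrite ler_pdivlMl; [exact: ltW|exact: lt_trans ltr01 ka1].
have k1 : ka^-1 < 1 by rewrite invf_lt1//; exact: lt_trans ltr01 ka1.
have h4 : (1 - ka^-1) * (P (n_ a) * cabs a ^+ 2) <= (1 - ka^-1) * W (n_ a).
  by apply: ler_wpM2l => //; lra.
have h5 : cabs a ^+ 2 * ((1 - ka^-1) * P (n_ a)) <= cabs a ^+ 2 * (P (n_ c) - P (n_ a)).
  lra.
by rewrite ler_pM2l ?exprn_gt0// in h5; lra.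
Qed.

(** * Lacunarity and sufficiency *)

(** The interval from [x] to [2 * x] is covered by two consecutive dyadic blocks, hence [M + M]. *)
Lemma lacunary_count (f : nat -> R) (A : set R[i]) (M : nat) (s : seq R[i]) :
  (forall k : int, atmost
    (A `&` \bigcup_(m in [set m | (2:R) ^ k <= f m <= (2:R) ^ (k + 1)]) Omega g m) M) ->
  uniq s -> (forall z, z \in s -> A z) -> forall x : R, 0 < x ->
  (count (fun z => x <= f (n_ z) < 2 * x)%R s <= M + M)%N.
Proof.
move=> hM us sA x x0; have [k /andP[k1 k2]] := exists_dyadic x0.
have block (j : int) :
    (count (fun z => (2 : R) ^ j <= f (n_ z) <= (2 : R) ^ (j + 1))%R s <= M)%N.
  rewrite -size_filter; move/atmostP : (hM j); apply; first exact: filter_uniq.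
  move=> z; rewrite mem_filter => /andP[zj /sA Az]; split=> //.
  by exists (n_ z) => //; exact: Omega_level.
apply: leq_trans (leq_add (block k) (block (k + 1))).
have := @count_le3 _ s (fun z => x <= f (n_ z) < 2 * x)
  (fun z => (2 : R) ^ k <= f (n_ z) <= (2 : R) ^ (k + 1))
  (fun z => (2 : R) ^ (k + 1) <= f (n_ z) <= (2 : R) ^ (k + 1 + 1)) pred0.
rewrite count_pred0 addn0; apply=> z zs /andP[h1 h2] /=.
rewrite [(2 : R) ^ (k + 1 + 1)]dyadic_double orbF.
have [h3|h3] := leP (f (n_ z)) ((2 : R) ^ (k + 1)).
  by rewrite (le_trans k1 h1).
by rewrite andbF (ltW h3) /=; lra.
Qed.

Section Sufficiency.
Variables (M0 MV MP : nat) (K0 : R).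
Hypothesis hM0 : forall n, atmost (L `&` Omega g n) M0.
Hypothesis hMV : forall k : int, atmost (LamV g v L `&`
  \bigcup_(m in [set m | (2:R) ^ k <= Vseq v m <= (2:R) ^ (k + 1)]) Omega g m) MV.
Hypothesis hMP : forall k : int, atmost (LamP g v L `&`
  \bigcup_(m in [set m | (2:R) ^ (- k - 1) <= P m <= (2:R) ^ (- k)]) Omega g m) MP.
Hypothesis hK0 : Lam0_condition K0.

Lemma level_count s n : uniq s -> (forall z, z \in s -> L z) ->
  (count (fun z => n_ z == n) s <= M0)%N.
Proof.
move=> us sL; rewrite -size_filter; move/atmostP : (hM0 n); apply; first exact: filter_uniq.
move=> z; rewrite mem_filter => /andP[/eqP <- /sL Lz]; split=> //; exact: Omega_level.
Qed.

Lemma rev_level_count s N n : uniq s -> (forall z, z \in s -> L z) ->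
  (forall z, z \in s -> (n_ z <= N)%N) ->
  (count (fun z => (N - n_ z)%N == n) s <= M0)%N.
Proof.
move=> us sL sN; apply: leq_trans (level_count (N - n)%N us sL).
have := @count_le3 _ s (fun z => (N - n_ z)%N == n) (fun z => n_ z == (N - n)%N) pred0 pred0.
rewrite !count_pred0 !addn0; apply=> z /sN zN /eqP <-.
by rewrite subKn// eqxx.
Qed.

(** [w_leW] replaces each summand by [4 / W], and [lacunary_sum] adds up the reciprocals: this is
    the passage from lacunarity to [V_condition]. *)
Lemma class_W (t : seq R[i]) (th : R) (N m : nat) : 1 < th ->
  (forall z, z \in t -> (0 < n_ z)%N) ->
  (forall x : R, 0 < x -> (count (fun z => x <= W (n_ z) < th * x)%R t <= N)%N) ->
  (0 < m)%N ->
  W m * (\sum_(z <- t | (m <= n_ z)%N) w z / cabs z ^+ 2) <= 4 * (N%:R * (th / (th - 1))).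
Proof.
move=> th1 t0 hN m0; have Wm : 0 < W m by rewrite -VseqW// Vseq_gt0.
have hN' (x : R) : 0 < x -> (count (fun z => x <= W (n_ z) < th * x) t)%:R <= N%:R :> R.
  by move=> x0; rewrite ler_nat hN.
have := lacunary_sum th1 hN' Wm; rewrite ler_pdivlMr// mulrC => h.
apply: (@le_trans _ _ (W m * (4 * \sum_(z <- t | W m <= W (n_ z)) (W (n_ z))^-1))); last first.
  by rewrite mulrCA ler_wpM2l.
apply: ler_wpM2l; first exact: ltW.
rewrite mulr_sumr; apply: ler_sum_cond => z /t0 z0.
  by move=> mz; split; [exact: W_le|exact: w_leW].
by move=> _; rewrite mulr_ge0// invr_ge0 W_ge0.
Qed.

Lemma class_P (t : seq R[i]) (th : R) (N m : nat) : 1 < th ->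
  (forall x : R, 0 < x -> (count (fun z => x <= P (n_ z) < th * x)%R t <= N)%N) ->
  P m * (\sum_(z <- t | (n_ z <= m)%N) w z) <= 4 * (N%:R * (th / (th - 1))).
Proof.
move=> th1 hN; have Pm := P_gt0 m.
have hN' (x : R) : 0 < x -> (count (fun z => x <= P (n_ z) < th * x) t)%:R <= N%:R :> R.
  by move=> x0; rewrite ler_nat hN.
have := lacunary_sum th1 hN' Pm; rewrite ler_pdivlMr// mulrC => h.
apply: (@le_trans _ _ (P m * (4 * \sum_(z <- t | P m <= P (n_ z)) (P (n_ z))^-1))); last first.
  by rewrite mulrCA ler_wpM2l.
apply: ler_wpM2l; first exact: ltW.
rewrite mulr_sumr; apply: ler_sum_cond => z _.
  by move=> mz; split; [exact: P_anti|exact: w_leP].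
by move=> _; rewrite mulr_ge0// invr_ge0 P_ge0.
Qed.

Section Classes.
Variable t : seq R[i].
Hypothesis ut : uniq t.
Hypothesis tL : forall z, z \in t -> L z.
Hypothesis t0 : forall z, z \in t -> (0 < n_ z)%N.

Let N := (\max_(z <- t) n_ z)%N.

Lemma t_le z : z \in t -> (n_ z <= N)%N.
Proof. by move=> zt; apply: leq_bigmax_seq. Qed.

Lemma z_sqr_gt0 z : z \in t -> 0 < cabs z ^+ 2.
Proof. by move=> /t0/level_gt0_cabs z0; rewrite exprn_gt0. Qed.

Lemma sub_inv_gt1 (ka : R) : 1 < ka -> 1 < 2 - ka^-1.
Proof.
move=> k1; have : ka^-1 < 1 by rewrite invf_lt1//; exact: lt_trans ltr01 k1.
lra.
Qed.

Lemma V_class_W : (forall z, z \in t -> LamV g v L z) ->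
  forall x : R, 0 < x -> (count (fun z => x <= W (n_ z) < 2 * x)%R t <= MV + MV)%N.
Proof.
move=> tV x x0; apply: leq_trans (lacunary_count hMV ut tV x0).
rewrite leq_eqVlt; apply/orP; left; apply/eqP; apply: eq_in_count => z /t0 z0.
by rewrite VseqW.
Qed.

Lemma P_class_P : (forall z, z \in t -> LamP g v L z) ->
  forall x : R, 0 < x -> (count (fun z => x <= P (n_ z) < 2 * x)%R t <= MP + MP)%N.
Proof.
move=> tP x x0; apply: (lacunary_count (A := LamP g v L)) => // k.
(* The blocks of [P_lacunary] are numbered by descending powers of 2; the substitution restores the
   ascending order. *)
have := hMP (- k - 1).
have -> : - (- k - 1) - 1 = k :> int by lia.
by have -> : - (- k - 1) = k + 1 :> int by lia.
Qed.

(** Levels are reversed because [P] grows towards lower levels. A drop of [W] by [ka = 2] yields the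
    growth factor [2 - 2^-1] of [P]. *)
Lemma V_class_P : (forall z, z \in t -> LamV g v L z) ->
  forall x : R, (count (fun z => x <= P (n_ z) < (2 - 2^-1) * x)%R t
    <= M0 + (MV + MV) + M0)%N.
Proof.
move=> tV; have k1 : 1 < 2 :> R by rewrite ltr1n.
apply: (@step_count R _ t (fun z => N - n_ z)%N (fun z => P (n_ z))
  (fun z => W (n_ z)) 2 (2 - 2^-1) M0) => //.
- by have := sub_inv_gt1 k1; lra.
- by move=> n; apply: rev_level_count => //; exact: t_le.
- move=> a b c at_ bt ct ab bc; have := t_le at_; have := t_le bt; have := t_le ct => cN bN aN.
  have ba : (n_ b < n_ a)%N by lia.
  have cb : (n_ c < n_ b)%N by lia.
  apply: growth_P (t0 ct) cb ba k1 _.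
  have [_ _ h] := LamV_elim (tV a at_) (t0 at_).
  rewrite VseqW ?(t0 at_)// ltr_pdivlMr ?z_sqr_gt0// in h; exact: ltW.
- exact: V_class_W.
- by move=> a at_; rewrite -VseqW ?t0// Vseq_gt0.
- move=> a b at_ bt ab; have := t_le at_; have := t_le bt => bN aN.
  by apply: W_lt; lia.
Qed.

Lemma P_class_W : (forall z, z \in t -> LamP g v L z) ->
  forall x : R, (count (fun z => x <= W (n_ z) < (2 - 2^-1) * x)%R t
    <= M0 + (MP + MP) + M0)%N.
Proof.
move=> tP; have k1 : 1 < 2 :> R by rewrite ltr1n.
apply: (@step_count R _ t level (fun z => W (n_ z))
  (fun z => P (n_ z)) 2 (2 - 2^-1) M0) => //.
- by have := sub_inv_gt1 k1; lra.
- by move=> n; apply: level_count.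
- move=> a b c at_ bt ct ab bc; apply: growth_W ab bc k1 _.
  have [_ _ _ h] := LamP_elim (tP a at_).
  by rewrite VseqW ?(t0 at_)// ltr_pdivrMr ?z_sqr_gt0// in h; exact: ltW.
- exact: P_class_P.
- by move=> a _; exact: P_gt0.
- by move=> a b _ _ ab; exact: P_lt.
Qed.

Lemma tieE z : z \in t -> tie z -> W (n_ z) = P (n_ z) * cabs z ^+ 2.
Proof.
by move=> zt [_ <-]; rewrite VseqW ?(t0 zt)// divfK// gt_eqF// z_sqr_gt0.
Qed.

(* [q^2] from the spacing of the moduli beats the growth factor [2 - 1/q <= q]
   of the other weight. *)
Lemma tie_spacing a b (x y : R) : a \in t -> b \in t -> ((n_ a).+1 < n_ b)%N ->
  0 < x -> y < (2 - q^-1) * x -> q * (cabs a ^+ 2 * y) < cabs b ^+ 2 * x.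
Proof.
move=> at_ bt ab x0 xy.
have qp := q0.
have th : 2 - q^-1 <= q.
  have : 0 <= (q - 1) ^+ 2 / q by rewrite divr_ge0 ?sqr_ge0// ltW.
  have -> : (q - 1) ^+ 2 / q = q - 2 + q^-1 by field; rewrite gt_eqF.
  lra.
have qab : q ^+ 2 * cabs a ^+ 2 <= cabs b ^+ 2.
  rewrite -exprMn ler_sqr ?nnegrE ?cabs_ge0 ?mulr_ge0 ?cabs_ge0 ?(ltW qp)//.
  exact: level_far.
apply: (@lt_le_trans _ _ (q * (cabs a ^+ 2 * (q * x)))).
  rewrite ltr_pM2l// ltr_pM2l ?z_sqr_gt0//; apply: lt_le_trans xy _.
  by apply: ler_wpM2r => //; exact: ltW.
have -> : q * (cabs a ^+ 2 * (q * x)) = q ^+ 2 * cabs a ^+ 2 * x by ring.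
by apply: ler_wpM2r => //; exact: ltW.
Qed.

Lemma tie_class_W : (forall z, z \in t -> tie z) ->
  forall x : R, (count (fun z => x <= W (n_ z) < (2 - q^-1) * x)%R t <= M0 + M0 + M0)%N.
Proof.
move=> tT.
apply: (@tie_count R _ t level (fun z => W (n_ z))
  (fun z => P (n_ z)) q (2 - q^-1) M0) => //.
- by have := sub_inv_gt1 q1; lra.
- by move=> n; apply: level_count.
- move=> a b c at_ bt ct ab bc; apply: growth_W ab bc q1 _.
  by rewrite -tieE// ; exact: tT.
- move=> a b at_ bt ab; have Wa : 0 < W (n_ a) by rewrite -VseqW ?t0// Vseq_gt0.
  (* [W = P |z|^2] at ties turns the spacing estimate into a drop of [P] by the factor [q]. *)
  move/(tie_spacing at_ bt ab Wa); rewrite (tieE at_ (tT _ at_)) (tieE bt (tT _ bt)).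
  have -> : q * (cabs a ^+ 2 * (P (n_ b) * cabs b ^+ 2)) =
    (cabs a ^+ 2 * cabs b ^+ 2) * (q * P (n_ b)) by ring.
  have -> : cabs b ^+ 2 * (P (n_ a) * cabs a ^+ 2) =
    (cabs a ^+ 2 * cabs b ^+ 2) * P (n_ a) by ring.
  by rewrite ltr_pM2l// mulr_gt0// z_sqr_gt0.
Qed.

Lemma tie_class_P : (forall z, z \in t -> tie z) ->
  forall x : R, (count (fun z => x <= P (n_ z) < (2 - q^-1) * x)%R t <= M0 + M0 + M0)%N.
Proof.
move=> tT.
apply: (@tie_count R _ t (fun z => N - n_ z)%N (fun z => P (n_ z))
  (fun z => W (n_ z)) q (2 - q^-1) M0) => //.
- by have := sub_inv_gt1 q1; lra.
- by move=> n; apply: rev_level_count => //; exact: t_le.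
- move=> a b c at_ bt ct ab bc; have := t_le at_; have := t_le bt; have := t_le ct => cN bN aN.
  have ba : (n_ b < n_ a)%N by lia.
  have cb : (n_ c < n_ b)%N by lia.
  by apply: growth_P (t0 ct) cb ba q1 _; rewrite -tieE//; exact: tT.
- move=> a b at_ bt ab; have := t_le at_; have := t_le bt => bN aN.
  have ba : ((n_ b).+1 < n_ a)%N by lia.
  move/(tie_spacing bt at_ ba (P_gt0 _)); rewrite (tieE at_ (tT _ at_)) (tieE bt (tT _ bt)).
  lra.
Qed.

End Classes.

(** Restricted to positive levels, where [classify] applies and [W] agrees with [Vseq]. *)
Let cls (X : set R[i]) (s : seq R[i]) := [seq z <- s | `[< X z >] && (0 < n_ z)%N].

Lemma cls_sum (s : seq R[i]) (Q : pred R[i]) (f : R[i] -> R) :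
  (forall z, z \in s -> L z) -> (forall z, 0 <= f z) -> (forall z, Q z -> (0 < n_ z)%N) ->
  \sum_(z <- s | Q z) f z <=
  \sum_(z <- cls (Lam0 g v L) s | Q z) f z + \sum_(z <- cls (LamV g v L) s | Q z) f z +
  \sum_(z <- cls (LamP g v L) s | Q z) f z + \sum_(z <- cls tie s | Q z) f z.
Proof.
move=> sL f0 Q0; rewrite !big_filter_cond.
rewrite big_mkcond [X in _ <= X + _ + _ + _]big_mkcond [X in _ <= _ + X + _ + _]big_mkcond.
rewrite [X in _ <= _ + _ + X + _]big_mkcond [X in _ <= _ + _ + _ + X]big_mkcond /=.
rewrite -!big_split /= big_seq [X in _ <= X]big_seq; apply: ler_sum => z /sL Lz.
case: ifPn => [/[dup] Qz /Q0 z0|_]; last by rewrite !andbF !addr0.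
have fz := f0 z; rewrite z0 !andbT.
have : [|| `[< Lam0 g v L z >], `[< LamV g v L z >], `[< LamP g v L z >] | `[< tie z >]].
  by case: (classify Lz z0) => /asboolT ->; rewrite ?orbT.
by case: asbool; case: asbool; case: asbool; case: asbool => //= _; lra.
Qed.

Lemma clsP X s z : z \in cls X s -> [/\ z \in s, X z & (0 < n_ z)%N].
Proof. by rewrite mem_filter => /andP[/andP[/asboolP Xz z0] zs]. Qed.

Lemma Lam0_esum (A : set R[i]) (f : R[i] -> R) (x K : R) (s : seq R[i]) : 0 <= x ->
  (x%:E * (\esum_(l in A) (f l)%:E) <= K%:E)%E -> uniq s ->
  (forall z, z \in s -> A z) -> x * \sum_(z <- s) f z <= K.
Proof.
move=> x0 h us sA; rewrite -lee_fin EFinM; apply: le_trans h.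
by rewrite lee_wpmul2l ?lee_fin// -sumEFin; exact: esum_ge_seq.
Qed.

Lemma Lam0_high n : ((Vseq v n)%:E * (\esum_(l in Lam0 g v L `&`
  [set l | (n <= n_ l)%N]) (FV (n_ l) l)%:E) <= K0%:E)%E.
Proof.
have := hK0 n; rewrite (esum_levels _ _ FV_ge0) (esum_levels _ _ FP_ge0).
apply: le_trans; rewrite leeDl// mule_ge0 ?lee_fin ?P_ge0//.
by apply: esum_ge0 => l _; rewrite lee_fin FP_ge0.
Qed.

Lemma Lam0_low n : ((P n)%:E * (\esum_(l in Lam0 g v L `&`
  [set l | (n_ l <= n)%N]) (FP (n_ l) l)%:E) <= K0%:E)%E.
Proof.
have := hK0 n; rewrite (esum_levels _ _ FV_ge0) (esum_levels _ _ FP_ge0).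
apply: le_trans; rewrite leeDr// mule_ge0 ?lee_fin ?(ltW (Vseq_gt0 _))//.
by apply: esum_ge0 => l _; rewrite lee_fin FV_ge0.
Qed.

(** One summand each for [LamV], [LamP] and ties: [4] from the bound on [w], the block count, and
    the geometric factor [th / (th - 1)] for the ratio of that class. [class_const'] is its analogue
    for [P]. *)
Definition class_const :=
  4 * ((MV + MV)%:R * (2 / (2 - 1))) +
  4 * ((M0 + (MP + MP) + M0)%:R * ((2 - 2^-1) / (2 - 2^-1 - 1))) +
  4 * ((M0 + M0 + M0)%:R * ((2 - q^-1) / (2 - q^-1 - 1))) : R.

Definition class_const' :=
  4 * ((M0 + (MV + MV) + M0)%:R * ((2 - 2^-1) / (2 - 2^-1 - 1))) +
  4 * ((MP + MP)%:R * (2 / (2 - 1))) +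
  4 * ((M0 + M0 + M0)%:R * ((2 - q^-1) / (2 - q^-1 - 1))) : R.

Lemma sufficient_V : V_condition (K0 + class_const).
Proof.
move=> s us sL m m0; have k1 : 1 < 2 :> R by rewrite ltr1n.
have := @cls_sum s (fun z => (m <= n_ z)%N) (fun z => w z / cabs z ^+ 2) sL.
move=> h; have {}h := h (fun z => divr_ge0 (w_ge0 z) (sqr_ge0 _)) (fun z => leq_trans m0).
apply: le_trans (ler_wpM2l (W_ge0 m) h) _; rewrite !mulrDr /class_const !addrA.
have clsL X z : z \in cls X s -> L z by move=> /clsP[/sL].
have cls0 X z : z \in cls X s -> (0 < n_ z)%N by move=> /clsP[].
have clsX X z : z \in cls X s -> X z by move=> /clsP[].
have clsu X : uniq (cls X s) by exact: filter_uniq.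
apply: lerD; first apply: lerD; first apply: lerD.
- set t := [seq z <- cls (Lam0 g v L) s | (m <= n_ z)%N].
  apply: le_trans (@Lam0_esum _ _ _ _ t (ltW (Vseq_gt0 m)) (Lam0_high m) _ _).
  + rewrite VseqW// ler_wpM2l ?W_ge0// /t -big_filter big_seq [X in _ <= X]big_seq.
    apply: ler_sum => z; rewrite mem_filter => /andP[_ zt]; rewrite FV_FP ler_wpM2r//.
      by rewrite invr_ge0 sqr_ge0.
    by apply: w_les; apply: Lg; exact: clsL zt.
  + exact: filter_uniq.
  + by move=> z; rewrite mem_filter => /andP[mz /clsX].
- apply: class_W => //; [exact: cls0|].
  by apply: V_class_W => //; [exact: cls0|exact: clsX].
- apply: class_W => //; [exact: sub_inv_gt1|exact: cls0|] => x _.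
  by apply: P_class_W => //; [exact: clsL|exact: cls0|exact: clsX].
- apply: class_W => //; [exact: sub_inv_gt1|exact: cls0|] => x _.
  by apply: tie_class_W => //; [exact: clsL|exact: cls0|exact: clsX].
Qed.

Lemma sufficient_P : P_condition (4 * M0%:R + (K0 + class_const')).
Proof.
move=> s us sL m; have k1 : 1 < 2 :> R by rewrite ltr1n.
(* The classes cover positive levels only. On level 0 each weight is at most [4 / P m] and there are
   at most [M0] points, whence the term [4 * M0%:R]. *)
rewrite (bigID (fun z => n_ z == 0%N)) /= mulrDr; apply: lerD.
  apply: (@le_trans _ _ (P m * \sum_(z <- s | n_ z == 0%N) 4 / P m)).
    apply: ler_wpM2l; first exact: P_ge0.
    apply: ler_sum_cond => z _; last by rewrite divr_ge0 ?P_ge0.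
    move=> /andP[zm z0]; split=> //; apply: le_trans (w_leP z) _.
    by apply: ler_wpM2l => //; rewrite lef_pV2 ?posrE ?P_gt0// P_anti.
  rewrite big_const_seq iter_addr_0 -[_ *+ _]mulr_natl mulrCA.
  have -> : P m * (4 / P m) = 4 by rewrite mulrCA mulfV ?mulr1// gt_eqF// P_gt0.
  by rewrite mulrC ler_wpM2l// ler_nat level_count.
have := @cls_sum s (fun z => (n_ z <= m)%N && (n_ z != 0%N)) w sL w_ge0.
move=> h; have {}h := h (fun z zQ => etrans (lt0n _) (andP zQ).2).
apply: le_trans (ler_wpM2l (P_ge0 m) h) _; rewrite !mulrDr /class_const' !addrA.
have clsL X z : z \in cls X s -> L z by move=> /clsP[/sL].
have cls0 X z : z \in cls X s -> (0 < n_ z)%N by move=> /clsP[].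
have clsX X z : z \in cls X s -> X z by move=> /clsP[].
have clsu X : uniq (cls X s) by exact: filter_uniq.
have drop X : P m * (\sum_(z <- cls X s | (n_ z <= m)%N && (n_ z != 0%N)) w z) <=
              P m * (\sum_(z <- cls X s | (n_ z <= m)%N) w z).
  apply: ler_wpM2l; first exact: P_ge0.
  by apply: ler_sum_cond => z _; [case/andP|move=> _; exact: w_ge0].
apply: lerD; first apply: lerD; first apply: lerD.
all: apply: le_trans (drop _) _.
- set t := [seq z <- cls (Lam0 g v L) s | (n_ z <= m)%N].
  apply: le_trans (@Lam0_esum _ _ _ _ t (P_ge0 m) (Lam0_low m) _ _).
  + rewrite ler_wpM2l ?P_ge0// /t -big_filter big_seq [X in _ <= X]big_seq.
    apply: ler_sum => z; rewrite mem_filter => /andP[_ zt].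
    by apply: w_les; apply: Lg; exact: clsL zt.
  + exact: filter_uniq.
  + by move=> z; rewrite mem_filter => /andP[mz /clsX].
- apply: class_P => //; first exact: sub_inv_gt1.
  by move=> x _; apply: V_class_P => //; [exact: clsL|exact: cls0|exact: clsX].
- apply: class_P => // x x0; apply: P_class_P => //; exact: clsX.
- apply: class_P => //; first exact: sub_inv_gt1.
  by move=> x _; apply: tie_class_P => //; [exact: clsL|exact: cls0|exact: clsX].
Qed.

Lemma sufficient_diagonal : diagonal_condition M0%:R.
Proof.
move=> s us sL m.
apply: (@le_trans _ _ (\sum_(z <- s | n_ z == m) 1)).
  apply: ler_sum => z _.
  rewrite weightE mulrC ler_pdivrMr ?S_gt0// mul1r.
  apply: le_trans (S_ge z m.+1); rewrite big_nat_recr//= lerDr.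
  by apply: sumr_ge0 => j _; exact: s_ge0.
by rewrite big_const_seq iter_addr_0 ler_nat level_count.
Qed.

End Sufficiency.

Lemma hilbert_bounded_iff :
  hilbert_bounded g v L w <->
  [/\ exists M : nat, forall n, atmost (L `&` Omega g n) M,
      V_lacunary g v (LamV g v L),
      P_lacunary g v (LamP g v L) &
      exists K : R, Lam0_condition K].
Proof.
split=> [/hilbert_bounded_truncation[K K0 hK]|[[M0 hM0] [MV hMV] [MP hMP] [K0 hK0]]].
  have hV := truncation_V K0 hK; have hP := truncation_P K0 hK.
  have hD := truncation_diagonal hK; have K4 : 0 <= 4 * K by rewrite mulr_ge0.
  split; [exact: (necessity_count K4 hV hP hD)| | |].
  - exact: (necessity_V K4 hV hP hD).
  - exact: (necessity_P K4 hP).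
  - exact: (necessity_Lam0 K4 hV hP hD).
have hV := sufficient_V hM0 hMV hMP hK0.
have hP := sufficient_P hM0 hMV hMP hK0.
have hD := sufficient_diagonal hM0.
have nilL z : z \in [::] -> L z by [].
(* The conditions on the empty list show that both constants are nonnegative. *)
have KV0 := hV [::] isT nilL 1%N isT; have KP0 := hP [::] isT nilL 0%N.
rewrite big_nil mulr0 in KV0; rewrite big_nil mulr0 in KP0.
apply: (truncation_hilbert_bounded (K := 3 * (4 * (K0 + class_const M0 MV MP) / d ^+ 2 + M0%:R
  + 4 * (4 * M0%:R + (K0 + class_const' M0 MV MP)) / d ^+ 2))).
  by rewrite mulr_ge0// !addr_ge0 ?ler0n// divr_ge0 ?sqr_ge0// mulr_ge0.
by move=> s us sL N a sN; apply: conditions_truncation.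
Qed.

End Sparse.

Theorem theorem4 (R : realType) (g : nat -> R[i]) (v : nat -> R) (L : set R[i]) :
  injective g ->
  (forall n, g n != 0) ->
  (exists q : R, 1 < q /\ forall n, q <= cabs (g n.+1) / cabs (g n)) ->
  (forall n, 0 < v n) ->
  (\sum_(0 <= n <oo) (v n / (1 + cabs (g n) ^+ 2))%:E < +oo)%E ->
  countable L ->
  (forall l n, L l -> l != g n) ->
  hilbert_bounded g v L (bessel_weight g v)
  <->
  [/\ exists M : nat, forall n, atmost (L `&` Omega g n) M,
      V_lacunary g v (LamV g v L),
      P_lacunary g v (LamP g v L) &
      exists K : R, forall n : nat,
        ((Vseq v n)%:E *
           (\esum_(m in [set m | (n <= m)%N])
              \esum_(l in Lam0 g v L `&` Omega g m)
                 (cabs (l - g m) ^+ 2 / (v m * cabs l ^+ 2))%:E)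
         + (Pseq g v n)%:E *
           (\esum_(m in [set m | (m <= n)%N])
              \esum_(l in Lam0 g v L `&` Omega g m)
                 (cabs (l - g m) ^+ 2 / v m)%:E)
         <= K%:E)%E].
Proof.
move=> _ g0 [q [q1 gq]] v0 vfin _ Lg.
have t0 n : 0 <= v n / (1 + cabs (g n) ^+ 2).
  by rewrite divr_ge0 ?(ltW (v0 _))// addr_ge0 ?sqr_ge0.
pose B0 := fine (\sum_(0 <= n <oo) (v n / (1 + cabs (g n) ^+ 2))%:E)%E.
have vB N : \sum_(0 <= n < N) (v n / (1 + cabs (g n) ^+ 2)) <= B0.
  rewrite -lee_fin fineK; last first.
    by rewrite ge0_fin_numE//; apply: nneseries_ge0 => n _ _; rewrite lee_fin.
  by rewrite -sumEFin; apply: nneseries_lim_ge => n _ _; rewrite lee_fin.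
exact: (hilbert_bounded_iff g0 q1 gq v0 vB Lg).
Qed.
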